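(* The circle $\mathbb{S}^1$ admits no expansive polycyclic group actions. That is, if $G$ is a polycyclic group and $\phi: G\to \mathrm{Homeo}(\mathbb{S}^1)$ is a group homomorphism, then the action $(\mathbb{S}^1, G,\phi)$ is not expansive.
   Context: For a topological space $X$, $\mathrm{Homeo}(X)$ is its homeomorphism group. A continuous action of a group $G$ on $X$ is a group homomorphism $\phi:G\to\mathrm{Homeo}(X)$ (no topology on $G$ is involved); write $gx$ for $\phi(g)(x)$. If $X$ is a compact metric space with metric $d$, a continuous action of $G$ on $X$ is called expansive if there is some $c>0$ such that for all $x\neq y$ in $X$ there is some $g\in G$ with $d(gx,gy)>c$. The circle $\mathbb{S}^1$ carries its usual metric. A group $G$ is polycyclic if it has a decreasing series of normal subgroups $G=N_0\rhd N_1\rhd\cdots\rhd N_n\rhd N_{n+1}=\{e\}$ such that $N_i/N_{i+1}$ is cyclic for each $i\ge 0$. *)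

(* Defs.v *)
From HB Require Import structures.
From mathcomp Require Import all_boot all_order all_algebra.
From mathcomp Require Import ring lra.
From mathcomp Require Import all_classical all_reals all_analysis.

Set Implicit Arguments.
Unset Strict Implicit.
Unset Printing Implicit Defensive.

Import Order.TTheory GRing.Theory Num.Theory.

Local Open Scope classical_set_scope.
Local Open Scope ring_scope.

Record homeo (X : topologicalType) := Homeo {
  homeo_fun :> X -> X;
  homeo_inv : X -> X;
  homeoK : cancel homeo_fun homeo_inv;
  homeoVK : cancel homeo_inv homeo_fun;
  homeo_continuous : continuous homeo_fun;
  homeo_inv_continuous : continuous homeo_inv
}.

Section HomeoGroup.
Context {X : topologicalType}.
Implicit Types f g h : homeo X.

Lemma homeo_ext f g : f =1 g -> f = g.
Proof.
case: f g => [f f' fK f'K cf cf'] [g g' gK g'K cg cg'] /= fg.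
have {}fg : f = g by apply/funext.
subst g.
have {}fg' : f' = g'.
  by apply/funext => x; rewrite -[in RHS](f'K x) gK.
subst g'.
by f_equal; exact: Prop_irrelevance.
Qed.

HB.instance Definition _ := gen_eqMixin (homeo X).
HB.instance Definition _ := gen_choiceMixin (homeo X).

Definition homeo_id : homeo X :=
  @Homeo X id id (fun=> erefl) (fun=> erefl) (fun=> cvg_id) (fun=> cvg_id).

Definition homeo_symm f : homeo X :=
  Homeo (@homeoVK _ f) (@homeoK _ f)
    (@homeo_inv_continuous _ f) (@homeo_continuous _ f).

Lemma continuous_compT (u v : X -> X) :
  continuous u -> continuous v -> continuous (u \o v).
Proof. by move=> cu cv x; apply: continuous_comp; [exact: cv | exact: cu]. Qed.

Definition homeo_comp f g : homeo X :=
  Homeo (can_comp (@homeoK _ f) (@homeoK _ g))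
    (can_comp (@homeoVK _ g) (@homeoVK _ f))
    (continuous_compT (@homeo_continuous _ f) (@homeo_continuous _ g))
    (continuous_compT (@homeo_inv_continuous _ g) (@homeo_inv_continuous _ f)).

Lemma homeo_compA : associative homeo_comp.
Proof. by move=> f g h; exact: homeo_ext. Qed.

Lemma homeo_comp1f : left_id homeo_id homeo_comp.
Proof. by move=> f; exact: homeo_ext. Qed.

Lemma homeo_compf1 : right_id homeo_id homeo_comp.
Proof. by move=> f; exact: homeo_ext. Qed.

Lemma homeo_compVf : left_inverse homeo_id homeo_symm homeo_comp.
Proof. by move=> f; apply: homeo_ext => x /=; rewrite homeoK. Qed.

Lemma homeo_compfV : right_inverse homeo_id homeo_symm homeo_comp.
Proof. by move=> f; apply: homeo_ext => x /=; rewrite homeoVK. Qed.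

HB.instance Definition _ := isGroup.Build (homeo X)
  homeo_compA homeo_comp1f homeo_compf1 homeo_compVf homeo_compfV.

End HomeoGroup.

Definition expansive (R : realType) (X : metricType R) (G : groupType)
    (phi : {multiplicative G -> homeo X}) : Prop :=
  exists2 c : R, 0 < c &
    forall x y : X, x <> y -> exists g : G, c < mdist (phi g x) (phi g y).

Definition circle (R : realType) : Type :=
  {p : R * R | p.1 ^+ 2 + p.2 ^+ 2 == 1}.

Section CircleMetric.
Context {R : realType}.
Implicit Types x y z : circle R.

Definition circle_dist x y : R :=
  Num.sqrt (((val x).1 - (val y).1) ^+ 2 + ((val x).2 - (val y).2) ^+ 2).

Lemma circle_distxx x : circle_dist x x = 0.
Proof. by rewrite /circle_dist !subrr expr0n /= addr0 sqrtr0. Qed.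

Lemma circle_dist_positivity x y : circle_dist x y = 0 -> x = y.
Proof.
move/eqP; rewrite sqrtr_eq0 => h.
have : ((val x).1 - (val y).1) ^+ 2 + ((val x).2 - (val y).2) ^+ 2 == 0.
  by rewrite eq_le h addr_ge0 ?sqr_ge0.
rewrite paddr_eq0 ?sqr_ge0 // !sqrf_eq0 !subr_eq0 => /andP[/eqP e1 /eqP e2].
by apply: val_inj; rewrite [LHS]surjective_pairing [RHS]surjective_pairing e1 e2.
Qed.

Lemma circle_dist_sym x y : circle_dist x y = circle_dist y x.
Proof. by rewrite /circle_dist; congr Num.sqrt; ring. Qed.

Lemma circle_dist_triangle y x z :
  circle_dist x z <= circle_dist x y + circle_dist y z.
Proof.
rewrite /circle_dist.
set a := (val x).1 - (val y).1; set b := (val x).2 - (val y).2.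
set c := (val y).1 - (val z).1; set d := (val y).2 - (val z).2.
have -> : (val x).1 - (val z).1 = a + c by rewrite /a /c; ring.
have -> : (val x).2 - (val z).2 = b + d by rewrite /b /d; ring.
have u0 : 0 <= a ^+ 2 + b ^+ 2 by rewrite addr_ge0 ?sqr_ge0.
have v0 : 0 <= c ^+ 2 + d ^+ 2 by rewrite addr_ge0 ?sqr_ge0.
have cs : a * c + b * d <= Num.sqrt (a ^+ 2 + b ^+ 2) * Num.sqrt (c ^+ 2 + d ^+ 2).
  rewrite -sqrtrM // (le_trans (ler_norm _)) // -sqrtr_sqr ler_sqrt.
    by rewrite -subr_ge0 [leRHS](_ : _ = (a * d - b * c) ^+ 2) ?sqr_ge0 //; ring.
  by rewrite mulr_ge0.
rewrite -[leRHS]ger0_norm ?addr_ge0 ?sqrtr_ge0 // -sqrtr_sqr ler_sqrt ?sqr_ge0 //.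
rewrite [leRHS]sqrrD !sqr_sqrtr //.
have -> : (a + c) ^+ 2 + (b + d) ^+ 2
        = a ^+ 2 + b ^+ 2 + (a * c + b * d) *+ 2 + (c ^+ 2 + d ^+ 2) by ring.
by rewrite lerD2r lerD2l lerMn2r cs.
Qed.

HB.instance Definition _ := Choice.on (circle R).
HB.instance Definition _ := @isMetric.Build R (circle R) circle_dist
  circle_distxx circle_dist_positivity circle_dist_sym circle_dist_triangle.

End CircleMetric.

Section Polycyclic.
Local Open Scope group_scope.

Definition expgz (G : groupType) (x : G) (k : int) : G :=
  match k with Posz n => x ^+ n | Negz n => x ^- n.+1 end.

Definition normal_subgroup (G : groupType) (N : {pred G}) : Prop :=
  group_closed N /\ forall g x, x \in N -> x ^ g \in N.

Definition left_coset (G : groupType) (H : {pred G}) (x : G) : set G :=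
  [set x * h | h in [set h | h \in H]].

(* For H normal in K, the elements of K / H are the cosets xH with x in K,
   and (aH)^k = (a^k)H. *)
Definition cyclic_quotient (G : groupType) (K H : {pred G}) : Prop :=
  exists2 a : G, a \in K &
    forall x : G, x \in K ->
      exists k : int, left_coset H x = left_coset H (expgz a k).

(* The terms of the series are required to be normal in the whole group G, not
   merely each one in its predecessor. The distinction matters here: the
   affine group Z[sqrt 2] ><| <1 + sqrt 2> has a subnormal series with cyclic
   factors, and its action on the one-point compactification of the line is
   expansive. The values of N beyond n.+1 are irrelevant. *)
Definition polycyclic (G : groupType) : Prop :=
  exists (n : nat) (N : nat -> {pred G}),
    [/\ N 0%N =i predT,
        N n.+1 =i pred1 1,
        forall i, (i <= n.+1)%N -> normal_subgroup (N i),
        forall i, (i <= n)%N -> {subset N i.+1 <= N i} &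
        forall i, (i <= n)%N -> cyclic_quotient (N i) (N i.+1)].

End Polycyclic.

(* Main.v *)
(** Expansiveness on the circle lifts to the line: the increasing lifts of the
    maps phi(g) form a group Gamma of order automorphisms of R for which some
    interval K = [u, v] is "expanding", every nondegenerate subinterval of K
    being mapped by Gamma onto an interval containing K.  Gamma inherits a
    series of normal subgroups with cyclic factors, ending with the
    translations by 2 pi.

    Such a K is excluded for every continuum X, by induction on the length of
    a series of Gamma whose last term <T> is trivial or generated by a fixed
    point free T.  Let A be the next term.  One finds a convex block J
    containing (a part of) K, i.e. gJ = J or gJ disjoint from J for g in
    Gamma, whose stabilizer in A again acts on J as a trivial group or as the
    powers of a fixed point free map; then one passes to the stabilizer of J
    acting on J.
    - If some nontrivial element of A has a fixed point, those having one are
      the powers of a single c; Fix(c) is Gamma-invariant, and J is a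
      component of Fix(c) or of its complement.
    - If A acts freely, it is an archimedean ordered group and Gamma
      centralizes it.  An f in A with u < f u < v would contradict the
      expansion of [u, f u].  So either A is generated by its least positive
      element, or the y such that f^-1 u < y < f u for all positive f in A
      form a block J containing K with trivial stabilizer in A. *)

From HB Require Import structures.
Require Import Defs.
From mathcomp Require Import all_boot all_order all_algebra.
From mathcomp Require Import ring lra.
From mathcomp Require Import all_classical all_reals all_analysis.

Set Implicit Arguments.
Unset Strict Implicit.
Unset Printing Implicit Defensive.

Import Order.TTheory GRing.Theory Num.Theory.

Local Open Scope classical_set_scope.
Local Open Scope ring_scope.
Local Open Scope order_scope.
Local Open Scope group_scope.

(** * Subgroups and cyclic quotients *)

Section IntegerPowers.
Context {G : groupType}.
Implicit Types (x y : G) (k l : int).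

Lemma expgzS x k : expgz x (k + 1)%R = x * expgz x k.
Proof.
case: k => [n|[|n]] /=.
- by rewrite addn1 expgS.
- by rewrite expg1 mulgV.
- by rewrite [in RHS]expgSr invgM mulVKg subn1.
Qed.

Lemma expgzB1 x k : expgz x (k - 1)%R = x^-1 * expgz x k.
Proof. by rewrite -{2}[k](subrK 1%R) expgzS mulKg. Qed.

Lemma expgzD x k l : expgz x (k + l)%R = expgz x k * expgz x l.
Proof.
elim: k => [|n IH|n IH]; first by rewrite add0r mul1g.
  by rewrite -addn1 PoszD addrAC !expgzS IH mulgA.
by rewrite -addn1 PoszD opprD addrAC !expgzB1 IH mulgA.
Qed.

Lemma expgzN x k : expgz x (- k)%R = (expgz x k)^-1.
Proof. by apply/eqP; rewrite -mulg_eq1 -expgzD addNr. Qed.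

Lemma expgzV x k : expgz x^-1 k = expgz x (- k)%R.
Proof. by rewrite expgzN; case: k => n /=; rewrite expVgn // invgK. Qed.

Lemma commute_expgz x y k : commute x y -> commute x (expgz y k).
Proof.
by case: k => n cxy; [exact: commuteX | apply/commuteV/commuteX].
Qed.

End IntegerPowers.

Section Subgroups.
Context {G : groupType}.
Implicit Types (S M Gamma : set G) (f g : G).

Definition subgroup S := S 1 /\ forall f g, S f -> S g -> S (f / g).

Definition normalized Gamma S := forall f g, S f -> Gamma g -> S (f ^ g).

Definition powers f : set G := [set expgz f k | k in setT].

(* [deg f k] reads "f lies in the coset a^k M"; unlike the choice of a
   generator a, such a relation restricts to subgroups of [M']. *)
Definition cyclic_over M' M := exists deg : G -> int -> Prop,
  [/\ forall f, M' f -> exists k, deg f k,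
      forall f g k l, deg f k -> deg g l -> deg (f / g) (k - l)%R &
      forall f, M' f -> deg f 0 -> M f].

Lemma subgroupV S f : subgroup S -> S f -> S f^-1.
Proof. by move=> [S1 SB] Sf; rewrite -div1g; exact: SB. Qed.

Lemma subgroupM S f g : subgroup S -> S f -> S g -> S (f * g).
Proof. by move=> Ss Sf Sg; rewrite -[g]invgK; apply: Ss.2 => //; exact: subgroupV. Qed.

Lemma subgroup_expgz S f k : subgroup S -> S f -> S (expgz f k).
Proof.
move=> Ss Sf; elim: k => [|n IH|n IH]; first exact: Ss.1.
  by rewrite -addn1 PoszD expgzS; exact: subgroupM.
by rewrite -addn1 PoszD opprD expgzB1; apply: subgroupM => //; exact: subgroupV.
Qed.

Lemma subgroup_powers f : subgroup (powers f).
Proof.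
split; first by exists 0%R.
by move=> _ _ [k _ <-] [l _ <-]; exists (k - l)%R; rewrite // expgzD expgzN.
Qed.

Lemma int_subgroup_cyclic (D : set int) :
  D 0%R -> (forall k l, D k -> D l -> D (k - l)%R) ->
  exists2 d, D d & forall k, D k -> exists q, k = (q * d)%R.
Proof.
move=> D0 DB.
have DN k : D k -> D (- k)%R by move=> Dk; rewrite -sub0r; exact: DB.
have DD k l : D k -> D l -> D (k + l)%R.
  by move=> Dk Dl; rewrite -[l]opprK; apply: DB => //; exact: DN.
have [[n [n0 Dn]]|noD] := pselect (exists n : nat, (0 < n)%N /\ D n%:Z); last first.
  exists 0%R => // k Dk; exists 0%R; rewrite mul0r.
  case: k Dk => [[//|n]|n] Dk; case: noD.
    by exists n.+1.
  by exists n.+1; split => //; move/DN: Dk; rewrite NegzE opprK.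
have exP : exists n, `[< (0 < n)%N /\ D n%:Z >] by exists n; apply/asboolP.
case: (ex_minnP exP) => d /asboolP [d0 Dd] dmin.
exists d%:Z => // k Dk; exists (k %/ d)%Z.
have Dm q : D (q * d%:Z)%R.
  elim: q => [|q IH|q IH]; first by rewrite mul0r.
    by rewrite -addn1 PoszD mulrDl mul1r; exact: DD.
  by rewrite -addn1 PoszD opprD mulrDl mulN1r; exact: DB.
have Dr : D (k %% d)%Z by rewrite /modz; apply: DB.
rewrite {1}(divz_eq k d).
have r0 : (0 <= k %% d%:Z)%Z%R by rewrite modz_ge0 // eqz_nat -lt0n.
have rd : ((k %% d%:Z)%Z < d%:Z)%R by rewrite ltz_pmod.
case E : (k %% d%:Z)%Z r0 rd Dr => [[|r]|r] // _ rd Dr; first by rewrite addr0.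
have : (d <= r.+1)%N by apply: dmin; exact/asboolP.
by rewrite leqNgt -ltz_nat rd.
Qed.

(** The degrees attained on [S] form a subgroup of the integers; [c] has a generating degree, so a
    suitable power of [c] brings any [f] to degree 0. *)
Lemma cyclic_over_subgroup M' M S : cyclic_over M' M -> subgroup S ->
  S `<=` M' ->
  exists2 c, S c & forall f, S f -> exists k, M (f * expgz c k).
Proof.
move=> [deg [degE degB deg0]] Ss SM'.
have d1 : deg 1 0%R.
  by have [k dk] := degE _ (SM' _ Ss.1); rewrite -(mulgV 1) -(subrr k); exact: degB.
have degV f k : deg f k -> deg f^-1 (- k)%R.
  by move=> dk; rewrite -div1g -sub0r; exact: degB.
have degM f g k l : deg f k -> deg g l -> deg (f * g) (k + l)%R.
  by move=> dk /degV dl; rewrite -[g]invgK -[l]opprK; exact: degB.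
have degX f k l : deg f k -> deg (expgz f l) (l * k)%R.
  move=> dk; elim: l => [|n IH|n IH]; first by rewrite mul0r.
    by rewrite -addn1 PoszD expgzS mulrDl mul1r addrC; exact: degM.
  rewrite -addn1 PoszD opprD expgzB1 mulrDl mulN1r addrC; apply: degM => //.
  exact: degV.
have [||d [c Sc dc] dP] := @int_subgroup_cyclic [set k | exists2 f, S f & deg f k].
- by exists 1 => //; exact: Ss.1.
- move=> k l [f Sf fk] [g Sg gl]; exists (f / g); first exact: Ss.2.
  exact: degB.
exists c => // f Sf; have [k fk] := degE _ (SM' _ Sf).
have [|q qE] := dP k; first by exists f.
exists (- q)%R; apply: deg0.
  by apply: SM'; apply: subgroupM => //; exact: subgroup_expgz.
rewrite (_ : 0%R = (k + (- q) * d)%R); last by rewrite qE mulNr subrr.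
by apply: degM => //; exact: degX.
Qed.

End Subgroups.

(** * Order automorphisms *)

Record oaut d (X : orderType d) := Oaut {
  oaut_fun :> X -> X;
  oaut_inv : X -> X;
  oautK : cancel oaut_fun oaut_inv;
  oautVK : cancel oaut_inv oaut_fun;
  oaut_homo : {homo oaut_fun : x y / x < y}
}.

Section OautGroup.
Context {d} {X : orderType d}.
Implicit Types f g h : oaut X.

Lemma oaut_ext f g : f =1 g -> f = g.
Proof.
case: f g => [f f' fK f'K cf] [g g' gK g'K cg] /= fg.
have {}fg : f = g by apply/funext.
subst g.
have {}fg' : f' = g' by apply/funext => x; rewrite -[in RHS](f'K x) gK.
subst g'.
by f_equal; exact: Prop_irrelevance.
Qed.

HB.instance Definition _ := gen_eqMixin (oaut X).
HB.instance Definition _ := gen_choiceMixin (oaut X).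

Lemma oaut_inv_homo f : {homo @oaut_inv _ _ f : x y / x < y}.
Proof.
move=> x y xy; case: ltgtP => //.
  by move/(oaut_homo f); rewrite !oautVK ltNge (ltW xy).
by move/(congr1 f); rewrite !oautVK => E; rewrite E ltxx in xy.
Qed.

Definition oaut_id : oaut X :=
  @Oaut _ X id id (fun=> erefl) (fun=> erefl) (fun _ _ => id).

Definition oaut_symm f : oaut X :=
  Oaut (@oautVK _ _ f) (@oautK _ _ f) (@oaut_inv_homo f).

Definition oaut_comp f g : oaut X :=
  Oaut (can_comp (@oautK _ _ f) (@oautK _ _ g))
    (can_comp (@oautVK _ _ g) (@oautVK _ _ f))
    (fun x y xy => oaut_homo f (oaut_homo g xy)).

Lemma oaut_compA : associative oaut_comp.
Proof. by move=> f g h; exact: oaut_ext. Qed.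

Lemma oaut_comp1f : left_id oaut_id oaut_comp.
Proof. by move=> f; exact: oaut_ext. Qed.

Lemma oaut_compf1 : right_id oaut_id oaut_comp.
Proof. by move=> f; exact: oaut_ext. Qed.

Lemma oaut_compVf : left_inverse oaut_id oaut_symm oaut_comp.
Proof. by move=> f; apply: oaut_ext => x /=; rewrite oautK. Qed.

Lemma oaut_compfV : right_inverse oaut_id oaut_symm oaut_comp.
Proof. by move=> f; apply: oaut_ext => x /=; rewrite oautVK. Qed.

HB.instance Definition _ := isGroup.Build (oaut X)
  oaut_compA oaut_comp1f oaut_compf1 oaut_compVf oaut_compfV.

Lemma oaut1 x : (1 : oaut X) x = x. Proof. by []. Qed.

Lemma oautM f g x : (f * g) x = f (g x). Proof. by []. Qed.

Lemma oautVgK f x : f^-1 (f x) = x. Proof. exact: oautK. Qed.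

Lemma oautgVK f x : f (f^-1 x) = x. Proof. exact: oautVK. Qed.

Lemma lt_oaut f : {mono f : x y / x < y}.
Proof.
move=> x y; apply/idP/idP => [/(oaut_homo f^-1)|/oaut_homo //].
by rewrite !oautVgK.
Qed.

Lemma le_oaut f : {mono f : x y / x <= y}.
Proof. by move=> x y; rewrite !leNgt lt_oaut. Qed.

Lemma oaut_inj f : injective f. Proof. exact: can_inj (oautVgK f). Qed.

Lemma lt_oautV f x y : (f^-1 x < y) = (x < f y).
Proof. by rewrite -(lt_oaut f) oautgVK. Qed.

Lemma lt_oautVr f x y : (x < f^-1 y) = (f x < y).
Proof. by rewrite -(lt_oaut f) oautgVK. Qed.

Lemma le_oautV f x y : (f^-1 x <= y) = (x <= f y).
Proof. by rewrite -(le_oaut f) oautgVK. Qed.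

Lemma le_oautVr f x y : (x <= f^-1 y) = (f x <= y).
Proof. by rewrite -(le_oaut f) oautgVK. Qed.

Lemma fixedV f x : f x = x -> f^-1 x = x.
Proof. by move=> {1}<-; rewrite oautVgK. Qed.

Lemma fixed_expgz f k x : f x = x -> expgz f k x = x.
Proof.
move=> fx; elim: k => [|n IH|n IH]; first by [].
  by rewrite -addn1 PoszD expgzS oautM IH.
by rewrite -addn1 PoszD opprD expgzB1 oautM IH fixedV.
Qed.

End OautGroup.

(** * Orbits, suprema and fixed points of order automorphisms *)

Section Continuum.
Context {d : Order.disp_t} {X : orderType d}.
Implicit Types (f g h T : oaut X) (x y z : X) (Gamma A S : set (oaut X)) (J : set X).

Definition order_dense (Y : porderType d) :=
  forall x y : Y, x < y -> exists2 z, x < z & z < y.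

Definition order_complete (Y : porderType d) := forall S : set Y,
  S !=set0 -> ubound S !=set0 -> supremums S !=set0.

Definition up f := forall x, x < f x.

Definition expanding Gamma u v := u < v /\ forall x y, u <= x -> x < y -> y <= v ->
  exists2 g, Gamma g & g x <= u /\ v <= g y.

Definition convex J := forall x y z, J x -> J z -> x <= y -> y <= z -> J y.

Definition stable J f := forall x, J x -> J (f x).

(** Only one inclusion is demanded; when [Gamma] is a subgroup, applying the condition to the
    inverse gives equality. *)
Definition block Gamma J :=
  forall g x, Gamma g -> J x -> J (g x) -> stable J g.

Lemma up_expgz f k : up f -> (0 < k)%R -> up (expgz f k).
Proof.
move=> uf; case: k => // [[//|n]] _ x; rewrite /=.
elim: n => [|n IH]; first by rewrite expg1.
by rewrite expgS oautM (lt_trans IH).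
Qed.

Lemma up_le_expgz f k x : up f -> (0 < k)%R -> f x <= expgz f k x.
Proof.
move=> uf; case: k => // [[//|n]] _; rewrite /=.
elim: n => [|n IH]; first by rewrite expg1.
by rewrite (le_trans IH) // (expgS _ n.+1) oautM ltW.
Qed.

Lemma upJ f g : up f -> up (f ^ g).
Proof. by move=> uf x; rewrite conjgE !oautM lt_oautVr. Qed.

Lemma up_expgz_gt0 f k x : up f -> x < expgz f k x -> (0 < k)%R.
Proof.
move=> uf xk; case: (ltgtP 0%R k) => // [k0|k0]; last by move: xk; rewrite -k0 /= ltxx.
exfalso; move: xk; apply/negP; move: x.
have := @up_expgz f (- k)%R uf; rewrite oppr_gt0 => /(_ k0) uN x.
by have := uN x; rewrite expgzN lt_oautVr -leNgt => /ltW.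
Qed.

Lemma expanding_sub Gamma u v u' v' : expanding Gamma u v ->
  u <= u' -> u' < v' -> v' <= v -> expanding Gamma u' v'.
Proof.
move=> [uv E] uu uv' vv; split => // x y ux xy yv.
have [g Gg [gx gy]] := E x y (le_trans uu ux) xy (le_trans yv vv).
by exists g => //; split; [exact: le_trans uu | exact: le_trans gy].
Qed.

Hypothesis Xd : order_dense X.
Hypothesis Xc : order_complete X.

(** A power of [T] moves all points in the same direction or none, whereas expanding [[x, v]] with
    [u < x] would move [x] strictly down but not [v]. *)
Lemma powers_not_expanding T u v : (T = 1 \/ up T) -> ~ expanding (powers T) u v.
Proof.
move=> T1 [uv E]; have [x ux xv] := Xd uv.
have [_ [k _ <-] [gx gv]] := E x v (ltW ux) xv (lexx _).
have {gx} gx : expgz T k x < x by exact: le_lt_trans gx ux.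
case: T1 => [T1|uT].
  have := @fixed_expgz _ _ T k x; rewrite T1 => /(_ erefl) E1.
  by rewrite T1 E1 ltxx in gx.
have k0 : (0 < - k)%R by apply: (@up_expgz_gt0 T _ x uT); rewrite expgzN lt_oautVr.
have := up_expgz uT k0 v; rewrite expgzN lt_oautVr => gv'.
by move: gv; rewrite leNgt gv'.
Qed.

(** [z] is the supremum of the forward orbit. Order automorphisms preserve suprema, so whatever maps
    the orbit onto a cofinal part of itself fixes [z]. *)
Lemma orbit_sup f x w : x < f x -> (forall n, (f ^+ n) x <= w) ->
  exists z, [/\ x <= z, z <= w, f z = z &
    forall g, (forall n, g ((f ^+ n) x) = (f ^+ n) x) -> g z = z].
Proof.
move=> xfx fw; set S := [set (f ^+ n) x | n in setT].
have [|| z [zub zlub]] := Xc (S := S).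
- by exists x, 0%N.
- by exists w => _ [n _ <-].
have gfix g : (forall n, exists m, g ((f ^+ n) x) <= (f ^+ m) x) ->
    (forall n, exists m, g^-1 ((f ^+ n) x) <= (f ^+ m) x) -> g z = z.
  move=> gS gVS; apply/eqP; rewrite eq_le; apply/andP; split.
    rewrite -le_oautVr; apply: zlub => _ [n _ <-]; rewrite le_oautVr.
    by have [m] := gS n; move=> /le_trans; apply; apply: zub; exists m.
  apply: zlub => _ [n _ <-]; rewrite -le_oautV.
  by have [m] := gVS n; move=> /le_trans; apply; apply: zub; exists m.
exists z; split.
- by apply: zub; exists 0%N.
- by apply: zlub => _ [n _ <-].
- apply: gfix => n; first by exists n.+1; rewrite expgS.
  exists n; rewrite le_oautV -oautM -expgS expgSr oautM.
  by rewrite le_oaut ltW.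
- move=> g gS; apply: gfix => n; exists n; first by rewrite gS.
  by rewrite fixedV.
Qed.

Lemma archimedean_up f x y : up f -> exists n, y < (f ^+ n) x.
Proof.
move=> uf; apply: contrapT => no.
have [|z [_ _ fz _]] := @orbit_sup f x y (uf x).
  by move=> n; rewrite leNgt; apply/negP => ?; apply: no; exists n.
by have := uf z; rewrite fz ltxx.
Qed.

Lemma archimedean_down f x y : up f -> exists n, (f ^- n) x < y.
Proof. by move=> /archimedean_up => /(_ y x)[n]; exists n; rewrite lt_oautV. Qed.

(** Division with remainder along the orbit of [x]: descend below [y] by a power of [f], then climb
    until the next step passes [y]. *)
Lemma up_floor f x y : up f -> exists2 s, powers f s & s x <= y /\ y < f (s x).
Proof.
move=> uf; have [p px] := archimedean_down x y uf.
have exP : exists n, y < (f ^+ n.+1) ((f ^- p) x).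
  have [n yn] := archimedean_up ((f ^- p) x) y uf; exists n.
  by rewrite expgS oautM (lt_trans yn).
case: (ex_minnP exP) => n yn nmin.
exists (f ^+ n / f ^+ p).
  exists (n%:Z - p%:Z)%R => //.
  by rewrite expgzD expgzN.
split; last by rewrite -oautM mulgA -expgS oautM.
rewrite oautM; case: n yn nmin => [|n] yn nmin; first exact: ltW.
by rewrite leNgt; apply/negP => /nmin; rewrite ltnn.
Qed.

Definition between x y z := (x <= z <= y) || (y <= z <= x).

(** An intermediate value theorem: the orbit of the smaller point under [f] or [f^-1] is bounded by
    the larger one, and its supremum is fixed. *)
Lemma fixpoint_between f x y : x < f x -> f y < y ->
  exists2 z, between x y z & f z = z.
Proof.
have key g a b : a < g a -> g b < b -> a < b -> exists2 z, a <= z <= b & g z = z.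
  move=> ag gb ab; have [|z [az zb gz _]] := @orbit_sup g a b ag.
    elim=> [|n IH]; first exact: ltW.
    by rewrite expgS oautM (le_trans _ (ltW gb)) // le_oaut.
  by exists z => //; rewrite az zb.
move=> xf fy; case: (ltgtP x y) => [xy|yx|E].
- by have [z zxy fz] := key f x y xf fy xy; exists z => //; rewrite /between zxy.
- have [||z zxy fz] := key f^-1 y x _ _ yx; rewrite ?lt_oautVr ?lt_oautV //.
  by exists z; [rewrite /between zxy orbT | rewrite -{1}fz oautgVK].
- by move: fy; rewrite -E ltNge (ltW xf).
Qed.

Lemma up_of_no_fixpoint f : (forall x, f x <> x) -> up f \/ up f^-1.
Proof.
move=> nf; have [[x xf]|no] := pselect (exists x, x < f x); last first.
  right=> x; rewrite lt_oautVr lt_neqAle; apply/andP; split; first exact/eqP/nf.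
  by rewrite leNgt; apply/negP => xfx; apply: no; exists x.
left=> y; case: (ltgtP y (f y)) => // [fy|/esym/nf //].
by have [z _ /nf] := fixpoint_between xf fy.
Qed.

(** A power of [T] carries [y] beyond [x] to another fixed point of [g], so the orbit of [x] under
    [g] or [g^-1], whichever goes up, is bounded. It consists of fixed points of [f], hence both
    maps fix its supremum. *)
Lemma common_fixpoint T f g x y : up T -> commute f g -> commute g T ->
  f x = x -> g y = y -> exists2 z, f z = z & g z = z.
Proof.
move=> uT fg gT fx gy.
have key h : commute f h -> commute h T -> h y = y -> x < h x ->
    exists2 z, f z = z & h z = z.
  move=> fh hT hy xh; have [n xn] := archimedean_up y x uT.
  have hw : h ((T ^+ n) y) = (T ^+ n) y.
    by rewrite -oautM (commuteX n hT) oautM hy.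
  have [|z [_ _ hz fz]] := @orbit_sup h x ((T ^+ n) y) xh.
    elim=> [|m IH]; first exact: ltW.
    by rewrite expgS oautM -hw le_oaut.
  exists z => //; apply: fz => m; rewrite -oautM.
  by rewrite (commuteX m fh) oautM fx.
have [xg|gx|gx] := ltgtP x (g x); last by exists x.
  exact: key.
have [||||z fz gz] := key g^-1.
- exact: commuteV.
- exact/commute_sym/commuteV/commute_sym.
- exact: fixedV.
- by rewrite lt_oautVr.
by exists z => //; rewrite -{1}gz oautgVK.
Qed.

End Continuum.

(** * Blocks and the induction step *)

Section Betweenness.
Context {d : Order.disp_t} {X : orderType d}.
Implicit Types (x y z : X) (P : set X).

Lemma between_split x y w z : between x y z -> between x w z \/ between w y z.
Proof.
rewrite /between; case: (leP w z) => [wz|/ltW zw] /orP[]/andP[h1 h2].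
- by right; rewrite ?wz h2.
- by left; rewrite ?wz h2 orbT.
- by left; rewrite h1 ?zw.
- by right; rewrite h1 ?zw orbT.
Qed.

Lemma between_oaut (f : oaut X) x y z : between x y z -> between (f x) (f y) (f z).
Proof. by rewrite /between !le_oaut. Qed.

Lemma betweenC x y z : between x y z = between y x z.
Proof. by rewrite /between orbC. Qed.

(** The union of all convex subsets of [P] that contain [x]; empty when [P x] fails. *)
Definition component P x : set X := [set y | forall z, between x y z -> P z].

Lemma component_refl P x : P x -> component P x x.
Proof. by move=> Px z; rewrite /between orbb => xz; rewrite -(le_anti xz). Qed.

Lemma component_sub P x : component P x `<=` P.
Proof. by move=> y; apply; rewrite /between !lexx andbT; exact: le_total. Qed.

Lemma component_convex P x : convex (component P x).
Proof.
move=> a b c Pa Pc ab bc z /(between_split a)[/Pa //|zab].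
have : between a c z.
  apply/orP; left; case/orP: zab => /andP[h1 h2].
    by rewrite h1 (le_trans h2).
  by rewrite (le_trans ab h1) (le_trans h2) // (le_trans ab).
rewrite betweenC => /(between_split x)[|/Pa //].
by rewrite betweenC => /Pc.
Qed.

(** [Gamma] preserves [P] and is closed under inverses, so it permutes the components of [P]. *)
Lemma component_block (Gamma : set (oaut X)) P x : subgroup Gamma ->
  (forall (g : oaut X) z, Gamma g -> P z -> P (g z)) -> block Gamma (component P x).
Proof.
move=> sG GP g a Gg Pa Pga b Pb z /(between_split (g a))[/Pga //|zab].
rewrite -(oautgVK g z); apply: GP => //.
have : between a b (g^-1 z) by rewrite -(oautVgK g a) -(oautVgK g b); exact: between_oaut.
by move=> /(between_split x)[|/Pb //]; rewrite betweenC => /Pa.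
Qed.

End Betweenness.

Section Step.
Context {d : Order.disp_t} {X : orderType d}.
Implicit Types (f g h c : oaut X) (u v x y z : X) (P J : set X).
Hypotheses (Xd : order_dense X) (Xc : order_complete X).
Variables (Gamma A : set (oaut X)) (T : oaut X) (u0 : X).
Hypotheses (sG : subgroup Gamma) (sA : subgroup A) (AG : A `<=` Gamma).
Hypotheses (nA : normalized Gamma A) (nT : normalized Gamma (powers T)).
Hypotheses (TA : powers T `<=` A) (cA : cyclic_over A (powers T)).

(** What the induction step delivers: the stabilizer of [J] in [Gamma] acts on [J], where [T'] takes
    the place of [T] and the stabilizer of [J] in [A] acts through powers of [T']. *)
Definition reduces_to (u v : X) (J : set X) (T' : oaut X) :=
  [/\ expanding Gamma u v, J u, J v, convex J & block Gamma J] /\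
  [/\ A T', stable J T', (forall x, J x -> T' x = x) \/ (forall x, J x -> x < T' x) &
      forall f, A f -> stable J f -> exists k, forall x, J x -> f x = expgz T' k x].

Definition reducible := exists u v J T', reduces_to u v J T'.

Lemma block_stableV J f x : block Gamma J -> Gamma f -> J x -> stable J f ->
  stable J f^-1.
Proof.
move=> bJ Gf Jx Jf; apply: (bJ _ (f x)); [exact: subgroupV | exact: Jf |].
by rewrite oautVgK.
Qed.

(** The orbit of [x] is unbounded in both directions, and [J] contains its convex hull. *)
Lemma stable_up_full J f x y : convex J -> stable J f -> stable J f^-1 -> up f ->
  J x -> J y.
Proof.
move=> cJ Jf JfV uf Jx.
have JX n : J ((f ^+ n) x) by elim: n => //= n IH; rewrite expgS oautM; exact: Jf.
have JXV n : J ((f ^- n) x).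
  by elim: n => [|n IH]; rewrite -?expVgn ?expgS ?oautM ?expVgn; [exact: Jx | exact: JfV].
have [n yn] := archimedean_up Xc x y uf; have [m my] := archimedean_down Xc x y uf.
by apply: (cJ _ _ _ (JXV m) (JX n)); exact: ltW.
Qed.

(** * A nontrivial element of [A] with a fixed point *)

Section WithFixpoints.
Variable c : oaut X.
Hypotheses (Ac : A c) (c1 : c <> 1) (cfix : exists x, c x = x).
Hypothesis Afix : forall f, A f -> (exists x, f x = x) -> powers c f.

(** The conjugate of [c] by [g] lies in [A] and has a fixed point, so it is a power of [c] and fixes
    every fixed point of [c]. *)
Lemma fix_invariant g x : Gamma g -> c x = x -> c (g x) = g x.
Proof.
move=> Gg cx; have [y cy] := cfix.
have [|k _ kE] := Afix (nA Ac Gg).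
  by exists (g^-1 y); rewrite conjgE !oautM oautgVK cy.
have /(congr1 g) : (c ^ g) x = x by rewrite -kE fixed_expgz.
by rewrite conjgE !oautM oautgVK.
Qed.

Lemma nofix_invariant g x : Gamma g -> c x <> x -> c (g x) <> g x.
Proof.
move=> Gg cx cgx; apply: cx.
by rewrite -(oautVgK g x); apply: fix_invariant => //; exact: subgroupV.
Qed.

(** If [f] had no fixed point, [f] or its inverse would be [up], and the stable component would be
    all of [X], including [y]. *)
Lemma stable_component_powers P x y f : P x -> ~ P y ->
  (forall g z, Gamma g -> P z -> P (g z)) -> A f -> stable (component P x) f ->
  powers c f.
Proof.
move=> Px nPy GP Af Jf; apply: Afix => //; apply: contrapT => nf.
have bJ := @component_block _ _ Gamma P x sG GP.
have cJ := @component_convex _ _ P x.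
have Jx := component_refl Px.
have JfV := block_stableV bJ (AG Af) Jx Jf.
apply: nPy; apply: (@component_sub _ _ _ x).
have [|uf|uf] := up_of_no_fixpoint Xc (f := f); first by move=> z fz; apply: nf; exists z.
  exact: (stable_up_full _ cJ Jf JfV uf Jx).
by apply: (stable_up_full _ cJ JfV _ uf Jx); rewrite invgK.
Qed.

Lemma nofix_subinterval u v x : u <= x <= v -> c x <> x -> u < v ->
  exists u' v', [/\ u <= u', u' < v', v' <= v &
    forall z, u' <= z <= v' -> c z <> z].
Proof.
move=> /andP[ux xv] cx uv.
(* [e] is whichever of [c] and [c^-1] moves [x] up. Fixed points above [x] are then at least [e x],
   and those below [x] are at most [e^-1 x]. *)
have [e xe eE] : exists2 e : oaut X, x < e x & forall z, c z = z -> e z = z.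
  case: (ltgtP x (c x)) => [xc|xc|/esym //]; first by exists c.
  by exists c^-1; [rewrite lt_oautVr | exact: fixedV].
have [xv'|vx] := ltP x v.
  have [|y xy] := @Xd x (Order.min (e x) v); first by rewrite lt_min xe.
  rewrite lt_min => /andP[ye yv]; exists x, y; split => //; first exact: ltW.
  move=> z /andP[xz zy] /eE ez; move: ye; rewrite ltNge; apply/negP/negPn.
  by rewrite (le_trans _ zy) // -ez le_oaut.
have [|y] := @Xd (Order.max (e^-1 x) u) x.
  by rewrite gt_max lt_oautV xe (lt_le_trans uv).
rewrite gt_max => /andP[ye yu] yx; exists y, x; split => //; first exact: ltW.
move=> z /andP[yz zx] /eE ez; move: ye; rewrite lt_oautV ltNge; apply/negP/negPn.
by rewrite (le_trans _ zx) // -ez le_oaut.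
Qed.

(** If [c] fixes [[u, v]] pointwise, [T'] is 1 on a component of the fixed set. Otherwise [[u, v]]
    is shrunk to an interval without fixed points, and [T'] is [c] or [c^-1], whichever moves its
    component up. *)
Lemma reducible_with_fixpoints u v : expanding Gamma u v -> reducible.
Proof.
move=> uvE; have uv := uvE.1.
have [allfix|/existsNP [x]] := pselect (forall x, u <= x <= v -> c x = x).
  pose P := [set x | c x = x].
  have GP g z : Gamma g -> P z -> P (g z) by exact: fix_invariant.
  have Pu : P u by apply: allfix; rewrite lexx ltW.
  have [y nPy] : exists y, ~ P y.
    apply: contrapT => no; apply: c1; apply: oaut_ext => y.
    by apply: contrapT => ?; apply: no; exists y.
  exists u, v, (component P u), 1; split; split => //.
  - exact: component_refl.
  - move=> z; rewrite /between => /orP[/allfix //|/andP[vz zu]].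
    by move: uv; rewrite ltNge (le_trans vz).
  - exact: component_convex.
  - exact: component_block.
  - exact: sA.1.
  - by left.
  - move=> f Af Jf; have [k _ fE] := stable_component_powers Pu nPy GP Af Jf.
    by exists 0%R => z /component_sub Pz; rewrite -fE fixed_expgz.
move=> /not_implyP [xuv cx].
have [u' [v' [uu uv' vv nf]]] := nofix_subinterval xuv cx uv.
pose P := [set x | c x <> x].
have GP g z : Gamma g -> P z -> P (g z) by exact: nofix_invariant.
have Pu : P u' by apply: nf; rewrite lexx ltW.
have [y cy] := cfix; have nPy : ~ P y by apply.
(* A fixed point between [u'] and [c u'] would be equal to [c u'], hence to [u'] as well. *)
have Jcu : component P u' (c u').
  move=> z /orP[]/andP[z1 z2] cz; apply: Pu.
    have E : c u' = z by apply/le_anti; rewrite z2 andbT -cz le_oaut.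
    by rewrite E; apply: (@oaut_inj _ _ c); rewrite E cz.
  have E : c u' = z by apply/le_anti; rewrite z1 -cz le_oaut.
  by rewrite E; apply: (@oaut_inj _ _ c); rewrite E cz.
have bJ := @component_block _ _ Gamma P u' sG GP.
have Ju := component_refl Pu.
have Jc : stable (component P u') c by apply: (bJ _ u') => //; exact: AG.
have JcV := block_stableV bJ (AG Ac) Ju Jc.
(* A change of direction inside the component would produce a fixed point between two of its
   points. *)
have signs : (forall x, component P u' x -> x < c x) \/
    (forall x, component P u' x -> x < c^-1 x).
  have [up_all|/existsNP [a /not_implyP [Ja /negP]]] :=
    pselect (forall x, component P u' x -> x < c x); first by left.
  rewrite -leNgt le_eqVlt => /orP[/eqP/(component_sub Ja) //|ca].
  right=> b Jb; rewrite lt_oautVr.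
  case: (ltgtP b (c b)) => // [bc|/esym/(component_sub Jb) //].
  have [z /(between_split u') zab cz] := fixpoint_between Xc bc ca.
  exfalso; move: cz; case: zab; first by rewrite betweenC => /Jb.
  by move=> /Ja.
exists u', v', (component P u').
have rest f : A f -> stable (component P u') f -> powers c f.
  exact: stable_component_powers Pu nPy GP.
have common : [/\ expanding Gamma u' v', component P u' u', component P u' v',
    convex (component P u') & block Gamma (component P u')].
  split => //; first exact: expanding_sub uvE uu uv' vv.
    move=> z; rewrite /between => /orP[/nf //|/andP[vz zu]].
    by move: uv'; rewrite ltNge (le_trans vz).
  exact: component_convex.
case: signs => signs; [exists c | exists c^-1]; split => //; split => //; try by right.
- by move=> f Af /(rest _ Af) [k _ <-]; exists k.
- exact: subgroupV.
- by move=> f Af /(rest _ Af) [k _ <-]; exists (- k)%R => z _; rewrite expgzV opprK.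
Qed.

End WithFixpoints.

Lemma reducible_full t u v : expanding Gamma u v -> A t -> (t = 1 \/ up t) ->
  A `<=` powers t -> reducible.
Proof.
move=> uvE At t1 Ap; exists u, v, setT, t; split; split => //.
- by case: t1 => [->|ut]; [left | right].
- by move=> f /Ap [k _ <-] _; exists k.
Qed.

(** * Commutation and fixed points above a fixed-point-free [T] *)

Section UpT.
Hypothesis uT : up T.

(** The conjugate of [T] by [h] is [up], so it is a positive power of [T] and moves points at least
    as far as [T]. The same for [h^-1] gives the reverse inequality. *)
Lemma commute_T g : Gamma g -> commute g T.
Proof.
have le_conj h x : Gamma h -> h (T x) <= T (h x).
  move=> Gh; have [k _ kE] : powers T (T ^ h) by apply: nT => //; exists 1%R.
  have k0 : (0 < k)%R by apply: (@up_expgz_gt0 _ _ T _ x uT); rewrite kE; exact: upJ.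
  by have := up_le_expgz x uT k0; rewrite kE conjgE !oautM le_oautVr.
move=> Gg; apply: oaut_ext => x; rewrite !oautM; apply/le_anti; rewrite le_conj //=.
have := le_conj g^-1 (g x) (subgroupV sG Gg).
by rewrite oautVgK le_oautV.
Qed.

Lemma commute_powers_T g s : Gamma g -> powers T s -> commute g s.
Proof. by move=> Gg [k _ <-]; apply: commute_expgz; exact: commute_T. Qed.

(** [A] is generated by [b] and the powers of [T], and [T] commutes with all of [Gamma]. *)
Lemma A_commute f g : A f -> A g -> commute f g.
Proof.
have [b Ab bE] := cyclic_over_subgroup cA sA (fun _ => id).
move=> Af Ag; have [k kE] := bE f Af; have [l lE] := bE g Ag.
rewrite -(mulgK (expgz b l) g); apply: commuteM.
  by apply: commute_powers_T => //; exact: AG.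
apply/commuteV/commute_sym; rewrite -(mulgK (expgz b k) f); apply: commuteM.
  by apply: commute_powers_T => //; apply: AG; exact: subgroup_expgz.
by apply: commuteV; apply: commute_expgz; apply/commute_sym; apply: commute_expgz.
Qed.

Lemma powers_T_fixpoint s x : powers T s -> s x = x -> s = 1.
Proof.
move=> [k _ <-]; case: (ltgtP 0%R k) => [k0|k0|<- //] sx.
  by have := up_expgz uT k0 x; rewrite sx ltxx.
have k0' : (0 < - k)%R by rewrite oppr_gt0.
by have := up_expgz uT k0' x; rewrite expgzN lt_oautVr sx ltxx.
Qed.

(** By [common_fixpoint], the elements of [A] with fixed points form a subgroup. [c] generates it
    modulo powers of [T], and the only power of [T] with a fixed point is 1. *)
Lemma fixpoint_subgroup_cyclic :
  exists2 c, A c /\ (exists x, c x = x) &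
    forall f, A f -> (exists x, f x = x) -> powers c f.
Proof.
pose S := [set f | A f /\ exists x, f x = x].
have sS : subgroup S.
  split; first by split; [exact: sA.1 | exists u0].
  move=> f g [Af [x fx]] [Ag [y gy]]; split; first exact: sA.2.
  have [z fz gz] := common_fixpoint Xc uT (A_commute Af Ag) (commute_T (AG Ag)) fx gy.
  by exists z; rewrite oautM fixedV.
have [c Sc cE] := cyclic_over_subgroup cA sS (fun f => @proj1 _ _).
exists c => // f Af fx.
have [k pk] := cE f (conj Af fx).
have [_ [x px]] := subgroupM sS (conj Af fx) (subgroup_expgz k sS Sc).
exists (- k)%R => //; rewrite expgzN; apply/esym/eqP.
by rewrite -mulg_eq1 (powers_T_fixpoint pk px).
Qed.

(** * Free action of [A] *)

Section FreeAction.
Hypothesis Afree : forall f, A f -> (exists x, f x = x) -> f = 1.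

Lemma free_cases f : A f -> [\/ f = 1, up f | up f^-1].
Proof.
move=> Af; have [fx|nf] := pselect (exists x, f x = x).
  by apply: Or31; exact: Afree.
have [x fx||] := up_of_no_fixpoint Xc (f := f); first by apply: nf; exists x.
  exact: Or32.
exact: Or33.
Qed.

Lemma free_up f x : A f -> x < f x -> up f.
Proof.
move=> /free_cases [-> ||uf] //; first by rewrite oaut1 ltxx.
by have := uf x; rewrite lt_oautVr => /ltW; rewrite leNgt => /negbTE ->.
Qed.

(** [f^-1 * g] moves one point up, hence every point: comparison at a single point orders [A]. *)
Lemma free_lt f g x y : A f -> A g -> f x < g x -> f y < g y.
Proof.
move=> Af Ag fg; rewrite -lt_oautVr; apply: (@free_up (f^-1 * g) x).
  by apply: subgroupM => //; exact: subgroupV.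
by rewrite oautM lt_oautVr.
Qed.

(* An automorphism of an archimedean ordered group fixing a positive element
   is the identity: otherwise the n-th powers of f and its image drift apart by
   more than T, although both lie in the same interval [s, T s). *)
Lemma conj_not_up f h : A f -> Gamma h -> ~ up (f ^ h / f).
Proof.
move=> Af Gh ug; set g := f ^ h / f in ug.
have Ag : A g by apply: sA.2 => //; exact: nA.
have [n xn] := archimedean_up Xc u0 (T u0) ug.
set F := f ^+ n.
have AF : A F by rewrite /F -[_ ^+ _]/(expgz f n); exact: subgroup_expgz.
have FhE : F ^ h = g ^+ n * F.
  by rewrite /F conjXg -[f ^ h](mulgVK f) expgMn //; exact: A_commute.
clearbody F.
have [s sT [sF Fs]] := up_floor Xc (F^-1 u0) u0 uT.
have As : A (T * s).
  by apply: subgroupM => //; apply: TA => //; exists 1%R.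
have Fs' z : F z < (T * s) z.
  by apply: (@free_lt _ _ (F^-1 u0)) => //; rewrite oautM oautgVK.
have hs : (T * s) ^ h = T * s.
  rewrite conjgE (_ : T * s * h = h * (T * s)) ?mulKg //.
  by apply: commute_sym; apply: commuteM; [exact: commute_T | exact: commute_powers_T].
have Fhs z : (F ^ h) z < (T * s) z.
  rewrite -hs !conjgE !oautM lt_oaut -oautM.
  exact: Fs'.
have := Fhs (F^-1 u0); rewrite FhE !oautM (oautgVK F) ltNge.
by rewrite (le_trans _ (ltW xn)) // le_oaut.
Qed.

Lemma free_central f h : A f -> Gamma h -> commute f h.
Proof.
move=> Af Gh; have Afh : A (f ^ h) by exact: nA.
suff E : f ^ h = f by rewrite /commute -{2}E conjgE mulVKg.
have [/eqP|uf|uf] := free_cases (sA.2 _ _ Afh Af).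
- by rewrite mulg_eq1 invgK => /eqP.
- by have := conj_not_up Af Gh uf.
(* When the inverse is [up], [f] and [f ^ h] exchange roles, with [h^-1] as conjugator. *)
- case: (@conj_not_up (f ^ h) h^-1 Afh (subgroupV sG Gh)).
  by rewrite conjgK -[f in f / _]invgK -invgM.
Qed.

(** Otherwise some [g] expands [[u, f u]] over [[u, v]]; since [f] and [g] commute,
    [v <= g (f u) = f (g u) <= f u]. *)
Lemma free_displacement u v f : expanding Gamma u v -> A f -> up f -> v <= f u.
Proof.
move=> [uv E] Af uf; rewrite leNgt; apply/negP => fuv.
have [g Gg [gu]] := E u (f u) (lexx _) (uf u) (ltW fuv).
rewrite -oautM -(free_central Af Gg) oautM leNgt; apply/negP/negPn.
by rewrite (le_lt_trans _ fuv) // le_oaut.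
Qed.

Section NoLeast.
Hypothesis no_least : forall f, A f -> up f ->
  exists g x, [/\ A g, up g & g x < f x].

(** [f] is a product of two [up] elements of [A]; the square of the smaller one is at most [f]. *)
Lemma free_half f : A f -> up f ->
  exists g, [/\ A g, up g & forall x, g (g x) <= f x].
Proof.
move=> Af uf; have [g1 [x [Ag1 ug1 g1f]]] := no_least Af uf.
pose g2 := g1^-1 * f.
have Ag2 : A g2 by apply: subgroupM => //; exact: subgroupV.
have ug2 : up g2 by move=> y; rewrite oautM lt_oautVr; exact: (free_lt (x := x)).
have fE y : f y = g1 (g2 y) by rewrite oautM oautgVK.
have [g12|g21] := leP (g1 u0) (g2 u0).
  exists g1; split => // y; rewrite fE le_oaut leNgt; apply/negP.
  by move=> /(free_lt u0 Ag2 Ag1); rewrite ltNge g12.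
by exists g2; split => // y; rewrite fE; apply/ltW; exact: free_lt g21.
Qed.

Lemma free_quarter f : A f -> up f ->
  exists g, [/\ A g, up g & forall x, g (g (g x)) <= f x].
Proof.
move=> Af uf; have [g [Ag ug gf]] := free_half Af uf.
have [k [Ak uk kg]] := free_half Ag ug; exists k; split => // x.
apply: le_trans (gf x); apply: le_trans (kg _); rewrite !le_oaut.
by rewrite (le_trans _ (kg _)) // ltW.
Qed.

Definition infinitesimal u := [set y | forall f, A f -> up f -> u < f y /\ y < f u].

Lemma infinitesimal_block u : block Gamma (infinitesimal u).
Proof.
move=> h a Gh Ja Jha b Jb f Af uf.
(* Three steps of size [k] suffice: one from [u] to [h a], and two from [a] to [b] by way of [u],
   which [h] respects because it commutes with [k]. *)
have [k [Ak uk kf]] := free_quarter Af uf.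
have kh z : k (h z) = h (k z) by rewrite -oautM free_central.
have [[ua au] [ub bu]] := (Ja _ Ak uk, Jb _ Ak uk); have [uha hau] := Jha _ Ak uk.
split; rewrite (lt_le_trans _ (kf _)) //.
  apply: (lt_trans uha); rewrite lt_oaut.
  have : h a < h (k (k b)) by rewrite lt_oaut (lt_trans au) // lt_oaut.
  by rewrite -!kh.
have : h b < h (k (k a)) by rewrite lt_oaut (lt_trans bu) // lt_oaut.
move=> /lt_trans; apply; rewrite -!kh !lt_oaut.
exact: hau.
Qed.

Lemma free_reducible u v : expanding Gamma u v -> reducible.
Proof.
move=> uvE; exists u, v, (infinitesimal u), 1; split; split => //.
- move=> f Af uf; split; first exact: lt_trans uvE.1 (uf v).
  (* [free_displacement] is not strict; applied to a [g] whose square is at most [f], it gives the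
     strict [v < f u]. *)
  have [g [Ag ug gf]] := free_half Af uf.
  rewrite (lt_le_trans _ (gf u)) // (le_lt_trans (free_displacement uvE Ag ug)) //.
- move=> a b e Ja Je ab be f Af uf; have [[ua _] [_ eu]] := (Ja f Af uf, Je f Af uf).
  by split; [rewrite (lt_le_trans ua) // le_oaut | exact: le_lt_trans eu].
- exact: infinitesimal_block.
- exact: sA.1.
- by left.
- move=> f Af Jf; exists 0%R => x _.
  (* [u] is in the block, so [f u] is too. This yields [f u < f u] if [f] is [up], and [u < u] if
     [f^-1] is. *)
  have Jfu : infinitesimal u (f u) by apply: Jf => g Ag ug.
  have [-> //|uf|uf] := free_cases Af.
    by have [_] := Jfu f Af uf; rewrite ltxx.
  by have [] := Jfu _ (subgroupV sA Af) uf; rewrite oautVgK ltxx.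
Qed.

End NoLeast.

(** Dividing [f] by powers of [t] leaves [s^-1 * f], which does not move [u0] down and moves it up
    by less than [t]; minimality leaves only the identity. *)
Lemma least_generates t : A t -> up t ->
  (forall f x, A f -> up f -> t x <= f x) -> A `<=` powers t.
Proof.
move=> At ut tmin f Af; have [s st [sf fs]] := up_floor Xc u0 (f u0) ut.
have As : A s by case: st => k _ <-; exact: subgroup_expgz.
suff -> : f = s by [].
have Ar : A (s^-1 * f) by apply: subgroupM => //; exact: subgroupV.
have [/eqP||] := free_cases Ar.
- by rewrite mulg_eq1 eqg_inv => /eqP.
- move=> ur; have := tmin _ u0 Ar ur; rewrite oautM le_oautVr -oautM.
  by rewrite -(A_commute At As) oautM leNgt fs.
- by move=> /(_ u0); rewrite lt_oautVr oautM lt_oautV ltNge sf.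
Qed.

Lemma reducible_free u v : expanding Gamma u v -> reducible.
Proof.
move=> uvE; have [[t [At ut tmin]]|no] := pselect (exists t, [/\ A t, up t &
    forall f x, A f -> up f -> t x <= f x]).
  by apply: (reducible_full uvE At); [right | exact: least_generates].
apply: (free_reducible _ uvE) => f Af uf; apply: contrapT => nof; apply: no.
exists f; split => // g x Ag ug; rewrite leNgt; apply/negP => gf; apply: nof.
by exists g, x.
Qed.

End FreeAction.

Lemma reducible_up u v : expanding Gamma u v -> reducible.
Proof.
move=> uvE; have [c [Ac cfix] cE] := fixpoint_subgroup_cyclic.
have [c1|c1] := pselect (c = 1); last exact: (reducible_with_fixpoints Ac c1 cfix cE uvE).
apply: (reducible_free _ uvE) => f Af /(cE f Af) [k _ <-].
by rewrite c1; apply: oaut_ext => x; apply: fixed_expgz.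
Qed.

End UpT.

(** For [T = 1] the group [A] is cyclic, and its generator is trivial, has a fixed point, or is [up]
    after possible inversion. *)
Lemma reducible_of_expanding u v : T = 1 \/ up T -> expanding Gamma u v -> reducible.
Proof.
case=> [T1|uT] uvE; last exact: reducible_up uT _ _ uvE.
have [b Ab bE] := cyclic_over_subgroup cA sA (fun _ => id).
have Ab' : A `<=` powers b.
  move=> f /bE [k [l _ lE]]; exists (- k)%R => //; rewrite expgzN; apply/esym/eqP.
  rewrite -mulg_eq1 -lE T1; apply/eqP; apply: oaut_ext => x; exact: fixed_expgz.
have [b1|b1] := pselect (b = 1); first by apply: (reducible_full uvE Ab) => //; left.
have [bfix|nob] := pselect (exists x, b x = x).
  by apply: (reducible_with_fixpoints Ab b1 bfix _ uvE) => f /Ab'.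
have [|ub|ub] := up_of_no_fixpoint Xc (f := b).
- by move=> x bx; apply: nob; exists x.
- by apply: (reducible_full uvE Ab) => //; right.
- apply: (reducible_full uvE (subgroupV sA Ab)); first by right.
  by move=> f /Ab' [k _ <-]; exists (- k)%R => //; rewrite expgzV opprK.
Qed.

End Step.

(** * Restriction to a convex set *)

Section Restriction.
Context {d : Order.disp_t} {X : orderType d}.
Variable P : pred X.

HB.instance Definition _ := [SubChoice_isSubOrder of {x | P x} by <: with d].

Notation Y := {x : X | P x}.

Lemma sub_order_dense : order_dense X -> convex [set x | P x] -> order_dense Y.
Proof.
move=> Xd cP x y xy; have [z xz zy] := Xd _ _ (xy : val x < val y).
have Pz : P z by apply: (cP (val x) z (val y)); rewrite ?ltW //; exact: valP.
by exists (exist _ z Pz).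
Qed.

Lemma sub_order_complete : order_complete X -> convex [set x | P x] ->
  order_complete Y.
Proof.
move=> Xc cP S [s Ss] [b bS].
have [|| z [zub zlub]] := Xc (val @` S).
- by exists (val s), s.
- by exists (val b) => _ [y Sy <-]; exact: bS.
have sz : val s <= z by apply: zub; exists s.
have zb : z <= val b by apply: zlub => _ [y Sy <-]; exact: bS.
have Pz : P z by apply: (cP (val s) z (val b)) => //; exact: valP.
exists (exist _ z Pz); split.
  by move=> y Sy; apply: (zub (val y)); exists y.
by move=> y yS; apply: (zlub (val y)) => _ [w Sw <-]; exact: yS.
Qed.

(** A relation rather than a function, since only automorphisms that map [P] onto itself have a
    restriction. *)
Definition restricts (f : oaut Y) (g : oaut X) := forall y, val (f y) = g (val y).

Lemma restricts_exists g : stable [set x | P x] g -> stable [set x | P x] g^-1 ->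
  exists f, restricts f g.
Proof.
move=> sg sgV.
pose F (y : Y) : Y := exist _ (g (val y)) (sg _ (valP y)).
pose FV (y : Y) : Y := exist _ (g^-1 (val y)) (sgV _ (valP y)).
have FK : cancel F FV by move=> y; apply: val_inj; exact: oautVgK.
have FVK : cancel FV F by move=> y; apply: val_inj; exact: oautgVK.
have Flt : {homo F : x y / x < y}.
  by move=> x y xy; exact: (oaut_homo g (xy : val x < val y)).
by exists (Oaut FK FVK Flt).
Qed.

Lemma restrictsM f g f' g' : restricts f g -> restricts f' g' ->
  restricts (f * f') (g * g').
Proof. by move=> fg fg' y; rewrite !oautM fg fg'. Qed.

Lemma restrictsV f g : restricts f g -> restricts f^-1 g^-1.
Proof. by move=> fg y; rewrite -{2}(oautgVK f y) fg oautVgK. Qed.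

Lemma restricts_expgz f g k : restricts f g -> restricts (expgz f k) (expgz g k).
Proof.
move=> fg; elim: k => [|n IH|n IH] //.
  by rewrite -addn1 PoszD !expgzS; exact: restrictsM.
by rewrite -addn1 PoszD opprD !expgzB1; apply: restrictsM => //; exact: restrictsV.
Qed.

Lemma restricts_stable f g : restricts f g -> stable [set x | P x] g.
Proof. by move=> fg x Px; rewrite /= -(fg (exist _ x Px)); exact: valP. Qed.

Definition restrictions (S : set (oaut X)) : set (oaut Y) :=
  [set f | exists2 g, S g & restricts f g].

Lemma restrictions_subgroup S : subgroup S -> subgroup (restrictions S).
Proof.
move=> [S1 SB]; split; first by exists 1.
move=> f f' [g Sg fg] [g' Sg' fg']; exists (g / g'); first exact: SB.
by apply: restrictsM => //; exact: restrictsV.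
Qed.

Lemma restrictions_normalized Gamma S : normalized Gamma S ->
  normalized (restrictions Gamma) (restrictions S).
Proof.
move=> nS f h [g Sg fg] [k Gk hk]; exists (g ^ k); first exact: nS.
by rewrite !conjgE; apply: restrictsM; [exact: restrictsV | exact: restrictsM].
Qed.

(** Elements with the same restriction may have different degrees, so the restriction inherits all
    of them; one witness of degree 0 suffices. *)
Lemma restrictions_cyclic_over M' M : subgroup M' -> cyclic_over M' M ->
  cyclic_over (restrictions M') (restrictions M).
Proof.
move=> sM' [deg [degE degB deg0]].
exists (fun f k => exists g, [/\ M' g, restricts f g & deg g k]); split.
- by move=> f [g M'g fg]; have [k gk] := degE g M'g; exists k, g.
- move=> f f' k k' [g [Mg fg gk]] [g' [Mg' fg' gk']]; exists (g / g'); split.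
  + exact: sM'.2.
  + by apply: restrictsM => //; exact: restrictsV.
  + exact: degB.
- by move=> f _ [g [Mg fg gk]]; exists g => //; exact: deg0.
Qed.

End Restriction.

(** The induction runs over all orders at once, since a step replaces [X] by a block [J]. The series
    restricted to [J] starts at [M 1], whose restriction consists of the powers of the new [T]. *)
Theorem no_expanding_interval m : forall d (X : orderType d)
    (M : nat -> set (oaut X)) (T : oaut X) u v,
  order_dense X -> order_complete X ->
  (forall i, (i <= m)%N -> subgroup (M i)) ->
  (forall i, (i <= m)%N -> normalized (M m) (M i)) ->
  (forall i, (i < m)%N -> M i `<=` M i.+1) ->
  (forall i, (i < m)%N -> cyclic_over (M i.+1) (M i)) ->
  M 0%N = powers T -> (T = 1 \/ up T) -> ~ expanding (M m) u v.
Proof.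
elim: m => [|m IH] d X M T u v Xd Xc sM nM MS cM M0 T1 uvE.
  by rewrite M0 in uvE; exact: powers_not_expanding Xd T u v T1 uvE.
have M1 j : (j <= m)%N -> M 1%N `<=` M j.+1.
  elim: j => [_ f //|j IHj jm]; apply: subset_trans (IHj (ltnW jm)) _.
  by apply: MS; rewrite ltnS.
have {}M1 := M1 m (leqnn m).
have sG := sM _ (leqnn m.+1); have sA := sM 1%N isT.
have nT : normalized (M m.+1) (powers T) by rewrite -M0; exact: nM.
have TA : powers T `<=` M 1%N by rewrite -M0; exact: MS.
have cA : cyclic_over (M 1%N) (powers T) by rewrite -M0; exact: cM.
have [u' [v' [J [T' [[E Ju Jv cJ bJ] [AT' sT' T'1 AE]]]]]] :=
  reducible_of_expanding Xd Xc u sG sA M1 (nM 1%N isT) nT TA cA T1 uvE.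
pose P : pred X := fun x => `[< J x >].
have PE : [set x | P x] = J by apply/seteqP; split => x /=; rewrite /P asboolE.
have bP : block (M m.+1) [set x | P x] by rewrite PE.
have cP : convex [set x | P x] by rewrite PE.
have Jval (y : {x | P x}) : J (val y) by have := valP y; rewrite /P asboolE.
have Pu : P u' by rewrite /P asboolE.
have Pv : P v' by rewrite /P asboolE.
have ex_res g : M m.+1 g -> stable J g -> exists f : oaut {x | P x}, restricts f g.
  move=> Gg sg; apply: restricts_exists; rewrite PE //.
  exact: (block_stableV sG bJ Gg Ju sg).
have [T'' T''E] := ex_res T' (M1 _ AT') sT'.
have := IH _ _ (fun i => restrictions (P:=P) (M i.+1)) T''
          (exist _ u' Pu) (exist _ v' Pv).
apply.
- exact: sub_order_dense.
- exact: sub_order_complete.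
- by move=> i im; apply: restrictions_subgroup; exact: sM.
- by move=> i im; apply: restrictions_normalized; exact: nM.
- by move=> i im f [g Mg fg]; exists g => //; exact: MS.
- by move=> i im; apply: restrictions_cyclic_over; [exact: sM | exact: cM].
- apply/seteqP; split => [f [g Ag fg]|_ [k _ <-]].
    have [|k kE] := AE g Ag; first by rewrite -PE; exact: restricts_stable fg.
    exists k => //; apply: oaut_ext => y; apply: val_inj.
    by rewrite fg kE // (restricts_expgz k T''E).
  by exists (expgz T' k); [exact: subgroup_expgz | exact: restricts_expgz].
- case: T'1 => T'1; [left|right].
    by apply: oaut_ext => y; apply: val_inj; rewrite T''E T'1.
  by move=> y; have := T'1 _ (Jval y); rewrite -T''E.
- split; first exact: E.1.
  move=> x y ux xy yv.
  have [g Gg [gx gy]] := E.2 (val x) (val y) ux xy yv.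
  (* [g^-1 u'] lies between [x] and [y], hence in [J], and [g] sends it to [u'], again in [J]. *)
  have Jg : stable J g.
    apply: (bJ g (g^-1 u')) => //; last by rewrite oautgVK.
    apply: (cJ (val x) _ (val y)) => //; first by rewrite le_oautVr.
    by rewrite le_oautV (le_trans (ltW E.1)).
  have [f fg] := ex_res g Gg Jg; exists f; first by exists g.
  by rewrite -!fg in gx gy; split; [exact: gx | exact: gy].
Qed.

Lemma expanding_of_family d (X : orderType d) (Gamma : set (oaut X)) (L : seq (X * X)) :
  (forall f g, Gamma f -> Gamma g -> Gamma (f * g)) ->
  (exists x y : X, x < y) -> (forall I, I \in L -> I.1 < I.2) ->
  (forall x y, x < y -> exists2 g, Gamma g & exists2 I, I \in L &
     g x <= I.1 /\ I.2 <= g y) ->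
  exists u v, expanding Gamma u v.
Proof.
move=> GM [x0 [y0 xy0]]; elim: L => [|[a b] L IH] Lpos LE.
  by have [g _ [I]] := LE _ _ xy0.
have ab : a < b by apply: (Lpos (a, b)); rewrite inE eqxx.
have [|nexp] := pselect (expanding Gamma a b); first by exists a, b.
have [s [t [a_s st tb nst]]] : exists s t, [/\ a <= s, s < t, t <= b &
    forall g, Gamma g -> ~ (g s <= a /\ b <= g t)].
  apply: contrapT => no; apply: nexp; split => // x y ax xy yb.
  apply: contrapT => ng; apply: no; exists x, y; split => // g Gg gxy.
  by apply: ng; exists g.
apply: IH => [I IL|x y xy]; first by apply: Lpos; rewrite inE IL orbT.
have [g Gg [I]] := LE x y xy; rewrite inE => /predU1P [->|IL] [gx gy]; last first.
  by exists g => //; exists I.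
have [h Gh [I']] := LE s t st; rewrite inE => /predU1P [->|IL'] [hs ht].
  by case: (nst h Gh).
exists (h * g); first exact: GM.
by exists I' => //; rewrite !oautM; split;
  [apply: le_trans hs | apply: (le_trans ht)]; rewrite le_oaut;
  [exact: le_trans a_s | exact: le_trans gy].
Qed.

Section OautOfSurj.
Context {d : Order.disp_t} {X : orderType d}.

Lemma oaut_of_surjection (F : X -> X) : {homo F : x y / x < y} ->
  (forall y, exists x, F x = y) -> exists f : oaut X, f =1 F.
Proof.
move=> Flt Fs; pose FV y := projT1 (cid (Fs y)).
have FVK : cancel FV F by move=> y; rewrite /FV; case: cid.
have Finj : injective F.
  by move=> x y; case: (ltgtP x y) => // /Flt /[swap] ->; rewrite ltxx.
have FK : cancel F FV by move=> x; apply: Finj; rewrite FVK.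
by exists (Oaut FK FVK Flt).
Qed.

End OautOfSurj.

Import numFieldNormedType.Exports.
Local Open Scope ring_scope.

(** * Lifting circle homeomorphisms to the line *)

Section CircleCover.
Context {R : realType}.
Implicit Types (s t x y a b : R) (z w : circle R).

Local Notation twopi := (pi *+ 2 : R).

Lemma twopi_gt0 : 0 < twopi.
Proof. by rewrite mulrn_wgt0 // pi_gt0. Qed.

Lemma cover_subproof t : (cos t, sin t).1 ^+ 2 + (cos t, sin t).2 ^+ 2 == 1 :> R.
Proof. by rewrite /= cos2Dsin2. Qed.

Definition cover t : circle R := exist _ (cos t, sin t) (cover_subproof t).

Lemma coverD t (k : int) : cover (t + twopi * k%:~R) = cover t.
Proof.
have step u : cover (u + twopi) = cover u.
  by apply: val_inj; rewrite /= cosD2pi sinD2pi.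
elim: k t => [|n IH|n IH] t; first by rewrite mulr0 addr0.
  by rewrite -(addn1 n) PoszD intrD mulrDr mulr1 addrA step IH.
rewrite -(addn1 n) PoszD opprD intrD mulrDr mulrN1 addrA -step subrK.
exact: IH.
Qed.

Lemma circle_dist_cover s t :
  circle_dist (cover s) (cover t) = Num.sqrt ((1 - cos (s - t)) *+ 2).
Proof.
rewrite /circle_dist /= cosB; congr Num.sqrt.
rewrite -[X in (X - _) *+ 2](_ : (cos s ^+ 2 + sin s ^+ 2 + (cos t ^+ 2 + sin t ^+ 2)) / 2 = 1).
  by field.
by rewrite !cos2Dsin2; field.
Qed.

(** The squared distance is [4 * sin u ^ 2] for the half angle [u], and the sine is positive
    strictly between 0 and [pi]. *)
Lemma cover_inj s t : cover s = cover t -> s <= t -> t < s + twopi -> s = t.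
Proof.
move=> E st ts; have := circle_dist_cover t s; rewrite E circle_distxx.
set u := (t - s) / 2; have -> : t - s = u *+ 2 by rewrite /u; field.
move/esym/eqP; rewrite sqrtr_eq0.
have -> : (1 - cos (u *+ 2)) *+ 2 = sin u ^+ 2 *+ 4.
  by rewrite cos_mulr2n cos2sin2; ring.
rewrite pmulrn_lle0 // => su; case: (ltgtP s t) st => // lt_st _.
have /sin_gt0_pi su0 : 0 < u < pi.
  by rewrite /u divr_gt0 ?subr_gt0 //= ltr_pdivrMr // ltrBlDl mulr_natr.
by move: su; rewrite leNgt exprn_gt0.
Qed.

Lemma cover_unif_cont (e : R) : 0 < e -> exists2 r, 0 < r &
  forall s t, `|s - t| < r -> circle_dist (cover s) (cover t) < e.
Proof.
move=> e0; have e2 : 0 < e ^+ 2 / 2 by rewrite divr_gt0 ?exprn_gt0.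
have /cvgrPdist_lt /(_ _ e2) := @continuous_cos R 0.
rewrite cos0 => /nbhs_ballP [r /= r0 rP]; exists r => // s t str.
rewrite circle_dist_cover -(ltr_pXn2r (n := 2)) ?nnegrE ?sqrtr_ge0 ?(ltW e0) //.
rewrite sqr_sqrtr; last by rewrite mulrn_wge0 // subr_ge0 cos_le1.
have := rP (s - t); rewrite /ball /= sub0r normrN => /(_ str).
move=> /ltr_normlW; lra.
Qed.

Lemma circle_ball z (e : R) : ball z e = [set w | circle_dist z w < e].
Proof. by rewrite ballEmdist. Qed.

Lemma continuous_cover : continuous (cover : R -> circle R).
Proof.
move=> s; apply/cvg_ballP => e e0; have [r r0 rP] := cover_unif_cont e0.
apply/nbhs_ballP; exists r => //= t /rP; by rewrite circle_ball.
Qed.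

Lemma circle_coord_le z w : `|(val z).1 - (val w).1| <= circle_dist z w /\
  `|(val z).2 - (val w).2| <= circle_dist z w.
Proof.
by rewrite /circle_dist -!sqrtr_sqr; split; rewrite ler_sqrt ?lerDl ?lerDr ?addr_ge0 ?sqr_ge0.
Qed.

Lemma continuous_coord1 : continuous (fun z => (val z).1 : R).
Proof.
move=> z; apply/(@cvgrPdist_lt _ _ _ _ (nbhs_filter z)) => e e0.
apply/nbhs_ballP; exists e => //= w.
by rewrite circle_ball; exact: le_lt_trans (circle_coord_le z w).1.
Qed.

Lemma continuous_coord2 : continuous (fun z => (val z).2 : R).
Proof.
move=> z; apply/(@cvgrPdist_lt _ _ _ _ (nbhs_filter z)) => e e0.
apply/nbhs_ballP; exists e => //= w.
by rewrite circle_ball; exact: le_lt_trans (circle_coord_le z w).2.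
Qed.

(* Half-angle formula: (x, y) = (cos t, sin t) with t in ]0, 2 pi[ has
   y / (1 - x) = cot (t / 2). *)
Definition punctured_angle x y : R := pi - atan (y / (1 - x)) *+ 2.

Lemma punctured_angleP x y : x ^+ 2 + y ^+ 2 = 1 -> x != 1 ->
  [/\ 0 < punctured_angle x y, punctured_angle x y < twopi,
      cos (punctured_angle x y) = x & sin (punctured_angle x y) = y].
Proof.
move=> xy x1; rewrite /punctured_angle; set m := y / (1 - x).
have x1' : 1 - x != 0 by rewrite subr_eq0 eq_sym.
have c2 : cos (atan m) ^+ 2 = (1 - x) / 2.
  rewrite cos_atan exprVn sqr_sqrtr; last by rewrite addr_ge0 ?sqr_ge0.
  have -> : 1 + m ^+ 2 = 2 / (1 - x).
    rewrite /m expr_div_n (_ : y ^+ 2 = (1 - x) * (1 + x)).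
      by field.
    by move: xy; lra.
  by rewrite invf_div.
have c0 : cos (atan m) != 0.
  by rewrite gt_eqF // cos_gt0_pihalf // atan_gtNpi2 atan_ltpi2.
have sE : sin (atan m) = m * cos (atan m).
  by rewrite -{2}(atanK m) /tan mulfVK.
split.
- have := atan_ltpi2 m; lra.
- have := atan_gtNpi2 m; lra.
- rewrite cosB cospi sinpi cos_mulr2n c2; lra.
- rewrite sinB cospi sinpi sin_mulr2n sE mulrCA -expr2 c2 /m; field.
  exact: x1'.
Qed.

End CircleCover.

(** * Angles from a base point and existence of lifts *)

Section Lifting.
Context {R : realType}.
Implicit Types (s t x y a b : R) (z w : circle R).

Local Notation twopi := (pi *+ 2 : R).

Let rot1 a z := cos a * (val z).1 + sin a * (val z).2.
Let rot2 a z := cos a * (val z).2 - sin a * (val z).1.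

(** The counterclockwise angle from [cover a] to [z]; [rot1] and [rot2] are the coordinates of [z]
    rotated by [- a]. The base point needs its own case, because division by zero would make
    [punctured_angle] return [pi] there. *)
Definition angle_from a z : R :=
  if z == cover a then 0 else punctured_angle (rot1 a z) (rot2 a z).

Lemma rot_norm a z : rot1 a z ^+ 2 + rot2 a z ^+ 2 = 1.
Proof.
have /eqP zE := valP z.
transitivity ((cos a ^+ 2 + sin a ^+ 2) * ((val z).1 ^+ 2 + (val z).2 ^+ 2)).
  by rewrite /rot1 /rot2; ring.
by rewrite cos2Dsin2 zE mulr1.
Qed.

Lemma rotK a z : (val z).1 = cos a * rot1 a z - sin a * rot2 a z /\
  (val z).2 = sin a * rot1 a z + cos a * rot2 a z.
Proof.
have E x : x = (cos a ^+ 2 + sin a ^+ 2) * x by rewrite cos2Dsin2 mul1r.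
by split; rewrite [LHS]E /rot1 /rot2; ring.
Qed.

Lemma rot1_neq1 a z : z <> cover a -> rot1 a z != 1.
Proof.
move=> za; apply/eqP => r1; apply: za; apply: val_inj.
have r2 : rot2 a z = 0.
  have := rot_norm a z; rewrite r1 expr1n => r2.
  by apply/eqP; rewrite -sqrf_eq0; apply/eqP; lra.
rewrite [LHS]surjective_pairing (rotK a z).1 (rotK a z).2 r1 r2.
by rewrite !mulr1 !mulr0 subr0 addr0.
Qed.

Lemma angle_from_gt0 a z : z <> cover a -> 0 < angle_from a z.
Proof.
move=> za; rewrite /angle_from ifN; last exact/eqP.
by have [] := punctured_angleP (rot_norm a z) (rot1_neq1 za).
Qed.

Lemma angle_from_base a : angle_from a (cover a) = 0.
Proof. by rewrite /angle_from eqxx. Qed.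

Lemma angle_from_ge0 a z : 0 <= angle_from a z.
Proof.
have [->|/eqP za] := eqVneq z (cover a); first by rewrite angle_from_base.
exact/ltW/angle_from_gt0.
Qed.

Lemma angle_from_lt a z : angle_from a z < twopi.
Proof.
rewrite /angle_from; case: eqP => [_|za]; first exact: twopi_gt0.
by have [] := punctured_angleP (rot_norm a z) (rot1_neq1 za).
Qed.

Lemma cover_angle_from a z : cover (a + angle_from a z) = z.
Proof.
rewrite /angle_from; case: eqP => [->|za]; first by rewrite addr0.
have [_ _ cE sE] := punctured_angleP (rot_norm a z) (rot1_neq1 za).
apply: val_inj; rewrite [RHS]surjective_pairing /= cosD sinD cE sE.
by congr pair; [rewrite [RHS](rotK a z).1 | rewrite [RHS](rotK a z).2; ring].
Qed.

Lemma continuous_angle_from (q : R -> circle R) a t : continuous q ->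
  q t <> cover a ->
  {for t, continuous (fun s => punctured_angle (rot1 a (q s)) (rot2 a (q s)))}.
Proof.
move=> cq /rot1_neq1 r1.
have c1 : {for t, continuous (fun s => (val (q s)).1)}.
  exact: (continuous_comp (cq t) (@continuous_coord1 R (q t))).
have c2 : {for t, continuous (fun s => (val (q s)).2)}.
  exact: (continuous_comp (cq t) (@continuous_coord2 R (q t))).
rewrite /punctured_angle; apply: cvgB; first exact: cvg_cst.
have cA : {for t, continuous (fun s => atan (rot2 a (q s) / (1 - rot1 a (q s))))}.
  apply: (@continuous_comp _ _ _ (fun s => rot2 a (q s) / (1 - rot1 a (q s))));
    last exact: continuous_atan.
  apply: cvgM.
    by apply: cvgB; apply: cvgM => //; exact: cvg_cst.
  apply: cvgV; first by rewrite subr_eq0 eq_sym.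
  apply: cvgB; first exact: cvg_cst.
  by apply: cvgD; apply: cvgM => //; exact: cvg_cst.
exact: cvgMn.
Qed.

Definition turns t : int := Num.floor (t / twopi).

Lemma turnsP t : twopi * (turns t)%:~R <= t < twopi * (turns t)%:~R + twopi.
Proof.
have := floor_itv (t / twopi); rewrite -/(turns t) intrD.
rewrite ler_pdivlMr ?twopi_gt0 // ltr_pdivrMr ?twopi_gt0 // mulrDl mul1r.
by rewrite ![_ * twopi]mulrC.
Qed.

Lemma turnsD t (k : int) : turns (t + twopi * k%:~R) = turns t + k.
Proof.
rewrite /turns mulrDl mulrAC divff ?mul1r; last by rewrite gt_eqF // twopi_gt0.
by rewrite floorDrz ?intr_int // intrKfloor.
Qed.

(** On the first turn the lift is [a] plus the angle of [q t] from [cover a]; each further turn of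
    [t] adds [2 pi]. *)
Lemma lift_of_monotone (q : R -> circle R) a :
  q 0 = cover a -> (forall t (k : int), q (t + twopi * k%:~R) = q t) ->
  (forall s t, q s = q t -> cover s = cover t) -> (forall z, exists t, q t = z) ->
  (forall s t, 0 < s -> s < t -> t < twopi -> angle_from a (q s) < angle_from a (q t)) ->
  exists f : oaut R, (forall t, cover (f t) = q t) /\
    forall t, f (t + twopi) = f t + twopi.
Proof.
move=> q0 qper qinj qsurj qinc.
pose F t := a + angle_from a (q t) + twopi * (turns t)%:~R.
have qrem t : q t = q (t - twopi * (turns t)%:~R).
  by rewrite -[in LHS](subrK (twopi * (turns t)%:~R) t) qper.
have FP t : cover (F t) = q t by rewrite /F coverD cover_angle_from.
have Flt : {homo F : x y / x < y}.
  move=> s t st; have /andP[s1 s2] := turnsP s; have /andP[t1 t2] := turnsP t.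
  have : turns s <= turns t.
    by rewrite /turns le_floor // ler_pM2r ?invr_gt0 ?twopi_gt0 // ltW.
  rewrite le_eqVlt => /predU1P[E|lt_turns]; last first.
    have := angle_from_lt a (q s); have := angle_from_ge0 a (q t).
    move: lt_turns; rewrite -lezD1 -(ler_int R) intrD /F.
    by rewrite -(ler_pM2l twopi_gt0) mulrDr mulr1; lra.
  rewrite /F E ltrD2r ltrD2l (qrem s) (qrem t) E in s1 s2 *.
  set s' := s - _; set t' := t - _.
  have st' : s' < t' by rewrite ltrD2r.
  have s0 : 0 <= s' by rewrite subr_ge0.
  have t'2 : t' < twopi by rewrite ltrBlDl.
  (* [qinc] covers only the open interval; at [s' = 0] the angle is 0, and [qinj] makes it positive
     at [t']. *)
  move: s0; rewrite le_eqVlt => /predU1P[E0|s0]; last exact: qinc.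
  rewrite -E0 q0 angle_from_base angle_from_gt0 // -q0 => /qinj/esym E1.
  have := @cover_inj R 0 t' E1; rewrite add0r E0 (ltW st') => /(_ isT t'2) E2.
  by rewrite E2 ltxx in st'.
have Fsurj y : exists x, F x = y.
  pose k := turns (y - a); pose r := y - a - twopi * k%:~R.
  have /andP[r0 r2] : 0 <= r < twopi.
    have /andP[h1 h2] := turnsP (y - a).
    by rewrite /r subr_ge0 h1 ltrBlDl.
  have [t0 t0E] := qsurj (cover y).
  pose t := t0 - twopi * (turns t0)%:~R.
  have qt : q t = cover (a + r).
    rewrite /t -qrem t0E -[in RHS](coverD _ k) /r; congr cover; ring.
  have turns_t : turns t = 0.
    by rewrite /t -mulrN -intrN turnsD subrr.
  exists (t + twopi * k%:~R); rewrite /F qper turnsD turns_t add0r qt.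
  have -> : angle_from a (cover (a + r)) = r.
    have E := cover_angle_from a (cover (a + r)).
    have h0 := angle_from_ge0 a (cover (a + r)).
    have h1 := angle_from_lt a (cover (a + r)).
    set b := angle_from _ _ in E h0 h1 *.
    case: (leP b r) => br.
      by apply: (addrI a); apply: cover_inj E _ _; [rewrite lerD2l | lra].
    apply/esym; apply: (addrI a); apply: cover_inj (esym E) _ _; last lra.
    by rewrite lerD2l ltW.
  by rewrite /r; ring.
have [f fE] := oaut_of_surjection Flt Fsurj.
exists f; split => t; rewrite !fE ?FP // /F.
have -> : t + twopi = t + twopi * 1%:~R by rewrite mulr1.
by rewrite qper turnsD intrD mulrDr mulr1 addrA.
Qed.

Definition lifts (h : homeo (circle R)) (f : oaut R) :=
  (forall t, cover (f t) = h (cover t)) /\ forall t, f (t + twopi) = f t + twopi.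

(** A homeomorphism reversing orientation has decreasing lifts; precomposing with the sign change
    makes them order automorphisms. *)
Definition antilifts (h : homeo (circle R)) (f : oaut R) :=
  (forall t, cover (f t) = h (cover (- t))) /\ forall t, f (t + twopi) = f t + twopi.

Lemma cover_surj z : exists t, cover t = z.
Proof. by exists (0 + angle_from 0 z); exact: cover_angle_from. Qed.

Lemma coverB_twopi t : cover (twopi - t) = cover (- t).
Proof. by have := coverD (- t) 1; rewrite mulr1 addrC. Qed.

(** The angle of [h (cover t)] from [h (cover 0)] is continuous and injective on []0, 2 pi[], hence
    strictly monotone: increasing gives a lift, decreasing an antilift. *)
Lemma lifts_or_antilifts h : exists f, lifts h f \/ antilifts h f.
Proof.
have hinj : injective h := can_inj (@homeoK _ h).
have [a aE] := cover_surj (h (cover 0)).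
pose q t := h (cover t).
have cq : continuous q.
  by move=> t; apply: continuous_comp; [exact: continuous_cover | exact: homeo_continuous].
have q_neq t : 0 < t < twopi -> q t <> cover a.
  move=> /andP[t0 t2]; rewrite aE => /hinj/esym E.
  by have := cover_inj E (ltW t0); rewrite add0r => /(_ t2) E0; rewrite -E0 ltxx in t0.
pose I := `]0, twopi[ : interval R.
pose A t := punctured_angle (rot1 a (q t)) (rot2 a (q t)).
have AE t : t \in I -> A t = angle_from a (q t).
  by rewrite in_itv /= => /q_neq tE; rewrite /angle_from ifN //; exact/eqP.
have cA : {within [set` I], continuous A}.
  apply: continuous_in_subspaceT => t; rewrite inE /= in_itv /= => /q_neq tE.
  exact: continuous_angle_from.
have Ainj : {in I &, injective A}.
  move=> s t sI tI; rewrite !AE // => E.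
  have := cover_angle_from a (q s); rewrite E cover_angle_from => /hinj E'.
  move: sI tI; rewrite !in_itv /= => /andP[s0 s2] /andP[t0 t2].
  case: (leP s t) => st; first by apply: cover_inj => //; lra.
  by apply/esym; apply: cover_inj; [exact/esym | exact: ltW | lra].
have [inc|dec] := itv_continuous_inj_mono cA Ainj.
- have [||||| f [fE fD]] := @lift_of_monotone q a.
  + by rewrite aE.
  + by move=> t k; rewrite /q coverD.
  + by move=> s t /hinj.
  + move=> z; have [t tE] := cover_surj (homeo_inv h z); exists t.
    by rewrite /q tE homeoVK.
  + move=> s t s0 st t2; have sI : s \in I by rewrite in_itv /= s0 (lt_trans st).
    have tI : t \in I by rewrite in_itv /= t2 (lt_trans s0).
    by rewrite -!AE //; exact: inc.
  by exists f; left.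
- have [||||| f [fE fD]] := @lift_of_monotone (fun t => q (- t)) a.
  + by rewrite oppr0 aE.
  + by move=> t k; rewrite /q opprD -mulrN -intrN coverD.
  + move=> s t /hinj E; apply: val_inj.
    by have := congr1 val E; rewrite /= !cosN !sinN => -[ce /oppr_inj se]; rewrite ce se.
  + move=> z; have [t tE] := cover_surj (homeo_inv h z); exists (- t).
    by rewrite /q opprK tE homeoVK.
  + move=> s t s0 st t2; rewrite /q -(coverB_twopi s) -(coverB_twopi t) -!/(q _).
    have sI : twopi - s \in I by rewrite in_itv /=; apply/andP; split; lra.
    have tI : twopi - t \in I by rewrite in_itv /=; apply/andP; split; lra.
    by rewrite -!AE //; apply: dec => //; rewrite ltrD2l ltrN2.
  by exists f; right.
Qed.

End Lifting.

(** * The group of lifts of an expansive action *)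

Section LiftedGroup.
Context {R : realType}.
Implicit Types (s t x y : R) (h : homeo (circle R)) (f : oaut R).

Local Notation twopi := (pi *+ 2 : R).

Lemma shift_subproof : exists f : oaut R, f =1 (fun t => t + twopi).
Proof.
apply: oaut_of_surjection => [s t|t]; first by rewrite ltrD2r.
by exists (t - twopi); rewrite subrK.
Qed.

Definition shift : oaut R := projT1 (cid shift_subproof).

Lemma shiftE t : shift t = t + twopi.
Proof. by rewrite /shift; case: cid. Qed.

Lemma up_shift : up shift.
Proof. by move=> t; rewrite shiftE ltrDl twopi_gt0. Qed.

Lemma expgz_shift (k : int) t : expgz shift k t = t + twopi * k%:~R.
Proof.
elim: k => [|n IH|n IH]; first by rewrite mulr0 addr0.
  by rewrite -(addn1 n) PoszD expgzS oautM IH shiftE intrD; ring.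
rewrite -(addn1 n) PoszD opprD expgzB1 oautM IH intrD.
by apply: (@oaut_inj _ _ shift); rewrite oautgVK shiftE; ring.
Qed.

Lemma commute_shift f : (forall t, f (t + twopi) = f t + twopi) -> commute f shift.
Proof. by move=> fD; apply: oaut_ext => t; rewrite !oautM !shiftE fD. Qed.

Lemma periodic_of_commute f : commute f shift -> forall t, f (t + twopi) = f t + twopi.
Proof. by move=> fs t; rewrite -!shiftE -!oautM fs. Qed.

Lemma lifts_shift k : lifts 1%g (expgz shift k).
Proof.
split=> t; first by rewrite expgz_shift coverD.
by rewrite !expgz_shift addrAC.
Qed.

Lemma liftsM h f h' f' : lifts h f -> lifts h' f' -> lifts (h * h')%g (f * f')%g.
Proof.
move=> [fE fD] [f'E f'D]; split=> t; first by rewrite oautM fE f'E.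
by rewrite !oautM f'D fD.
Qed.

Lemma liftsV h f : lifts h f -> lifts h^-1%g f^-1%g.
Proof.
move=> [fE fD]; split=> [t|]; last first.
  apply: periodic_of_commute; apply/commute_sym/commuteV/commute_sym.
  exact: commute_shift.
by apply: (can_inj (@homeoK _ h)); rewrite -fE oautgVK [RHS](homeoVK h).
Qed.

Lemma liftsJ h f h' f' : lifts h f -> lifts h' f' -> lifts (h ^ h')%g (f ^ f')%g.
Proof.
by move=> hf hf'; rewrite !conjgE; apply: liftsM; [exact: liftsV | exact: liftsM].
Qed.

(** After composition with a translation, [F] fixes 0 and maps [[0, 2 pi[] to itself, where [cover]
    is injective; periodicity does the rest. *)
Lemma lifts1_powers f : lifts 1%g f -> powers shift f.
Proof.
move=> lf; have [f0E _] := lf.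
have /andP[k1 k2] := turnsP (f 0).
set k := turns (f 0) in k1 k2; exists k => //.
have f0 : f 0 = twopi * k%:~R.
  apply/eqP; rewrite -subr_eq0; apply/eqP/esym; apply: cover_inj; last first.
  - by rewrite ltrBlDl addrA addr0.
  - by rewrite subr_ge0.
  - by rewrite -mulrN -intrN coverD f0E.
pose F := ((expgz shift k)^-1 * f)%g.
have [FE FD] : lifts 1%g F.
  by rewrite -[1%g](mulVg 1%g); apply: liftsM => //; apply: liftsV; exact: lifts_shift.
have F0 : F 0 = 0.
  by apply: (@oaut_inj _ _ (expgz shift k)); rewrite oautM oautgVK f0 expgz_shift add0r.
suff F1 : F = 1%g by rewrite -[f](mulKg (expgz shift k)^-1%g) invgK -/F F1 mulg1.
have F1 t : 0 <= t < twopi -> F t = t.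
  move=> /andP[t0 t2].
  have Ft0 : 0 <= F t by rewrite -{1}F0 le_oaut.
  have Ft2 : F t < twopi by rewrite -[X in _ < X]add0r -[X in X + _]F0 -FD add0r lt_oaut.
  case: (leP (F t) t) => Ft; first by apply: cover_inj; [exact: FE | exact: Ft | lra].
  by apply/esym; apply: cover_inj; [exact/esym/FE | exact: ltW | lra].
apply: oaut_ext => t; pose S := expgz shift (turns t).
have St u : S u = u + twopi * (turns t)%:~R by exact: expgz_shift.
rewrite -[t](subrK (twopi * (turns t)%:~R)) -St -oautM.
rewrite (commute_expgz _ (commute_shift FD)) oautM F1 //.
by have /andP[t1 t2] := turnsP t; rewrite subr_ge0 t1 ltrBlDl.
Qed.

Lemma flip_subproof f : exists F : oaut R, F =1 (fun t => - f (- t)).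
Proof.
apply: oaut_of_surjection => [s t|t]; first by rewrite ltrN2 lt_oaut ltrN2.
by exists (- f^-1%g (- t)); rewrite opprK oautgVK opprK.
Qed.

(** Two reversals of orientation cancel: [F] is [f'] conjugated by the sign change. *)
Lemma antilifts_comp h f h' f' : antilifts h f -> antilifts h' f' ->
  exists2 F : oaut R, F =1 (fun t => - f' (- t)) & lifts (h * h')%g (f * F)%g.
Proof.
move=> [fE fD] [f'E f'D]; have [F FE] := flip_subproof f'; exists F => //.
split=> t; first by rewrite oautM fE FE opprK f'E opprK.
rewrite !oautM !FE -fD; congr (f _).
have -> : - t = - (t + twopi) + twopi by ring.
by rewrite f'D; ring.
Qed.

Variables (G : groupType) (phi : {multiplicative G -> homeo (circle R)}).

(** Only increasing lifts occur, so elements reversing orientation contribute nothing. *)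
Definition lifted (N : set G) : set (oaut R) :=
  [set f | exists2 g, N g & lifts (phi g) f].

Lemma phi1 : phi 1%g = 1%g.
Proof. by apply: (mulgI (phi 1%g)); rewrite -gmulfM !mulg1. Qed.

Lemma phiV g : phi g^-1%g = (phi g)^-1%g.
Proof. by apply: (mulgI (phi g)); rewrite -gmulfM !mulgV phi1. Qed.

Lemma lifted_shift N k : N 1%g -> lifted N (expgz shift k).
Proof. by move=> N1; exists 1%g => //; rewrite phi1; exact: lifts_shift. Qed.

Lemma lifted_subgroup N : subgroup N -> subgroup (lifted N).
Proof.
move=> [N1 NB]; split; first exact: (lifted_shift 0 N1).
move=> f f' [g Ng gf] [g' Ng' g'f']; exists (g / g')%g; first exact: NB.
by rewrite gmulfM phiV; apply: liftsM => //; exact: liftsV.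
Qed.

Lemma lifted_normalized N N' : normalized N N' -> normalized (lifted N) (lifted N').
Proof.
move=> nN f f' [g Ng gf] [g' Ng' g'f']; exists (g ^ g')%g; first exact: nN.
by rewrite !conjgE !gmulfM phiV -conjgE; exact: liftsJ.
Qed.

Lemma lifted_cyclic_over N' N : subgroup N' -> cyclic_over N' N ->
  cyclic_over (lifted N') (lifted N).
Proof.
move=> sN' [deg [degE degB deg0]].
exists (fun f k => exists g, [/\ N' g, lifts (phi g) f & deg g k]); split.
- by move=> f [g Ng gf]; have [k gk] := degE g Ng; exists k, g.
- move=> f f' k k' [g [Ng gf gk]] [g' [Ng' gf' gk']]; exists (g / g')%g; split.
  + exact: sN'.2.
  + by rewrite gmulfM phiV; apply: liftsM => //; exact: liftsV.
  + exact: degB.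
- by move=> f _ [g [Ng gf gk]]; exists g => //; exact: deg0.
Qed.

(** Up to whole turns, finitely many cells of a grid of mesh [e] suffice, as an interval of length
    [2 e] contains a cell. *)
Lemma grid_interval (e : R) : 0 < e -> exists n : nat, forall a b, a + e *+ 2 <= b ->
  exists i, exists2 k, (i < n)%N &
    a <= expgz shift k (e *+ i) /\ expgz shift k (e *+ i.+1) <= b.
Proof.
move=> e0; have [n nP] : exists n : nat, twopi / e < n%:R.
  exists (Num.truncn (twopi / e)).+1.
  by have /andP[] := truncn_itv (ltW (divr_gt0 twopi_gt0 e0)).
exists n.+1 => a b ab; have /andP[a1 a2] := turnsP a; set k := turns a in a1 a2.
pose c := a - twopi * k%:~R.
have c0 : 0 <= c by rewrite subr_ge0.
have c2 : c < twopi by rewrite ltrBlDl.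
have /andP[m1 m2] := truncn_itv (divr_ge0 c0 (ltW e0)); set m := Num.truncn _ in m1 m2.
rewrite ler_pdivlMr // mulr_natl in m1; rewrite ltr_pdivrMr // mulr_natl in m2.
(* Cell [m] contains [c], so the next one starts after [c] and ends no later than [c + 2 e]. *)
exists m.+1, k; rewrite ?expgz_shift.
  rewrite ltnS -(ltr_nat R); apply: le_lt_trans nP.
  by rewrite ler_pdivlMr // mulr_natl (le_trans m1) // ltW.
by split; move: m1 m2 ab; rewrite /c !mulrSr; lra.
Qed.

(** Points separated by [c] have lifts at least [r = 2 e] apart, so every interval can be mapped
    over one of finitely many grid cells. If the separating element reverses orientation, composing
    with a fixed antilift [f1] replaces the cell by its image under [f1]. *)
Lemma expansive_expanding : expansive phi -> exists u v, expanding (lifted setT) u v.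
Proof.
move=> [c c0 cP]; have [r r0 rP] := cover_unif_cont c0.
have e0 : 0 < r / 2 by rewrite divr_gt0.
have [n nP] := grid_interval e0; set e := r / 2 in e0 nP.
have far s t : s < t -> c < mdist (cover s) (cover t) -> s + e *+ 2 <= t.
  move=> st; apply: contraTT; rewrite -ltNge -leNgt => ts.
  apply/ltW/rP; rewrite ltr0_norm ?subr_lt0 // opprB.
  by move: ts; rewrite /e; lra.
pose L0 : seq (R * R) := [seq (e *+ i, e *+ i.+1) | i <- iota 0 n].
have inL0 i : (i < n)%N -> (e *+ i, e *+ i.+1) \in L0.
  by move=> i_n; apply/mapP; exists i; rewrite // mem_iota.
(* If no element has an antilift, the identity serves vacuously. *)
have [f1 f1D f1P] : exists2 f1 : oaut R, commute f1 shift &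
    forall g f, antilifts (phi g) f -> exists2 F : oaut R,
      F =1 (fun t => - f (- t)) & lifted setT (f1 * F)%g.
  have [[g1 [f1 g1f1]]|no] := pselect (exists g1 f1, antilifts (phi g1) f1).
    exists f1; first exact: commute_shift g1f1.2.
    move=> g f gf; have [F FE Ff] := antilifts_comp g1f1 gf.
    by exists F => //; exists (g1 * g)%g => //; rewrite gmulfM.
  by exists 1%g => [|g f gf]; [exact: (commute_sym (commute1 _)) | case: no; exists g, f].
have sG : subgroup (lifted setT) by apply: lifted_subgroup.
have := @expanding_of_family _ R (lifted setT) (L0 ++ [seq (f1 J.1, f1 J.2) | J <- L0]).
apply.
- by move=> f g; exact: subgroupM.
- by exists 0, 1; exact: ltr01.
- have L0P I : I \in L0 -> I.1 < I.2 by move=> /mapP[i _ ->] /=; rewrite mulrSr ltrDl.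
  move=> I; rewrite mem_cat => /orP[/L0P //|/mapP[J /L0P J12 ->]].
  by rewrite lt_oaut.
(* [x] and [y] may have the same image on the circle; cutting the interval at half a turn makes the
   images of its endpoints distinct. *)
move=> x y xy; pose y' := Num.min y (x + pi).
have xy' : x < y' by rewrite lt_min xy ltrDl pi_gt0.
have y'y : y' <= y by rewrite ge_min lexx.
have y'x : y' < x + twopi.
  by rewrite (@le_lt_trans _ _ (x + pi)) ?ge_min ?lexx ?orbT // ltrD2l mulr2n ltrDl pi_gt0.
have nxy : cover x <> cover y'.
  by move=> /cover_inj /(_ (ltW xy') y'x) E; move: xy'; rewrite -E ltxx.
have [g gxy] := cP _ _ nxy.
have shiftG k : lifted setT (expgz shift k)^-1%g.
  by apply: subgroupV => //; exact: lifted_shift.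
have [f [gf|gf]] := lifts_or_antilifts (phi g).
  rewrite -!gf.1 in gxy.
  have [|i [k i_n [fx fy]]] := nP (f x) (f y'); first by apply: far; rewrite ?lt_oaut.
  exists ((expgz shift k)^-1 * f)%g; first by apply: subgroupM => //; exists g.
  exists (e *+ i, e *+ i.+1); first by rewrite mem_cat inL0.
  rewrite !oautM le_oautV le_oautVr; split => //.
  by rewrite (le_trans fy) // le_oaut.
have [F FE GF] := f1P g f gf.
have gE t : phi g (cover t) = cover (- F t) by rewrite FE opprK gf.1 opprK.
rewrite !gE in gxy.
have [|i [k i_n [Fx Fy]]] := nP (F x) (F y').
  have := far (- F y') (- F x); rewrite ltrN2 lt_oaut metric_sym.
  by move=> /(_ xy' gxy); lra.
exists ((expgz shift k)^-1 * (f1 * F))%g; first exact: subgroupM.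
exists (f1 (e *+ i), f1 (e *+ i.+1)).
  by rewrite mem_cat; apply/orP; right; apply/mapP; exists (e *+ i, e *+ i.+1); rewrite ?inL0.
have comm t : expgz shift k (f1 t) = f1 (expgz shift k t).
  by rewrite -!oautM (commute_expgz k f1D).
rewrite !oautM le_oautV le_oautVr !comm !le_oaut; split => //.
by rewrite (le_trans Fy) // le_oaut.
Qed.

End LiftedGroup.

(** * From a polycyclic series to a series of groups of lifts *)

Lemma subgroup_of_normal (G : groupType) (N : {pred G}) :
  normal_subgroup N -> subgroup [set g | g \in N].
Proof. by move=> [[N1 NB] _]; split => // f g; exact: NB. Qed.

Lemma cyclic_over_of_quotient (G : groupType) (K H : {pred G}) :
  normal_subgroup H -> cyclic_quotient K H ->
  cyclic_over [set g | g \in K] [set g | g \in H].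
Proof.
move=> nH [a _ aK]; have sH := subgroup_of_normal nH.
exists (fun g k => ((expgz a k)^-1 * g)%g \in H); split.
- move=> g /aK [k kE]; exists k.
  have [x xH xE] : left_coset H (expgz a k) g.
    by rewrite -kE; exists 1%g; [exact: sH.1 | rewrite mulg1].
  by rewrite -xE mulKg.
- move=> f g k l fk gl.
  rewrite expgzD expgzN invgM invgK.
  rewrite (_ : (_ * _)%g = ((expgz a k)^-1 * f * ((expgz a l)^-1 * g)^-1) ^ (expgz a l)^-1)%g.
    by apply: nH.2; exact: sH.2.
  by rewrite conjgE invgK !invgM invgK !mulgA mulgK.
- by move=> g _; rewrite /= invg1 mul1g.
Qed.

Lemma real_order_complete (R : realType) : order_complete R.
Proof.
move=> S S0 Sb; exists (sup S); split; first exact: sup_upper_bound.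
by move=> b Sb'; exact: ge_sup.
Qed.

Theorem theorem1p1 (R : realType) (G : groupType)
    (phi : {multiplicative G -> homeo (circle R)}) :
  polycyclic G -> ~ expansive phi.
Proof.
move=> [n [N [N0 N1 nN NS cN]]] /expansive_expanding [u [v uvE]].
pose Ns i : set G := [set g | g \in N i].
(* The series is reversed and preceded by the translations: [M 0] and [M 1] both consist of the
   translations by multiples of [2 pi], and [M n.+2] is the group of all lifts. *)
pose M i := if i is j.+1 then lifted phi (Ns (n.+1 - j)%N) else powers (shift : oaut R).
have le_n j : (n.+1 - j <= n.+1)%N by rewrite leq_subr.
have sNs j : subgroup (Ns (n.+1 - j)%N) by apply: subgroup_of_normal; exact: nN.
have M1 : lifted phi (Ns n.+1) = powers shift.
  apply/seteqP; split=> [f [g]|_ [k _ <-]].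
    by rewrite /Ns /= N1 inE => /eqP ->; rewrite phi1; exact: lifts1_powers.
  by apply: lifted_shift; rewrite /Ns /= N1 inE.
have MT : M n.+2 = lifted phi setT.
  rewrite /M subnn; congr lifted; apply/seteqP; split => // g _.
  by rewrite /Ns /= N0.
have subN j : (j <= n)%N -> (n.+1 - j = (n - j).+1)%N by move=> jn; rewrite subSn.
apply: (@no_expanding_interval n.+2 _ R M shift u v).
- by move=> x y xy; exists ((x + y) / 2); rewrite midf_lt.
- exact: real_order_complete.
- by case=> [|j] _; [exact: subgroup_powers | exact: lifted_subgroup].
- rewrite MT; case=> [|j] _; rewrite /M -?M1.
    apply: lifted_normalized => f g; rewrite /Ns /= => fN _.
    by apply: (nN _ _).2.
  apply: lifted_normalized => f g; rewrite /Ns /= => fN _.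
  by apply: (nN _ _).2.
- case=> [|j] jn; rewrite /M; first by rewrite subn0 M1.
  move=> f [g gN gf]; exists g => //; rewrite subSS; rewrite subN // in gN.
  by apply: NS gN; exact: leq_subr.
- case=> [|j] jn; rewrite /M.
    (* [M 1] equals [M 0], so degree 0 can be given to every element. *)
    rewrite subn0 M1; exists (fun _ k => k = 0); split => //.
      by move=> f _; exists 0.
    by move=> _ _ k l -> ->; rewrite subrr.
  apply: lifted_cyclic_over; first exact: sNs.
  rewrite subSS subN //; apply: cyclic_over_of_quotient.
    by apply: nN; rewrite ltnS leq_subr.
  by apply: cN; exact: leq_subr.
- by [].
- by right; exact: up_shift.
- by rewrite MT.
Qed.
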